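(* Fix $m\ge0$ and let $T^{[m]}(z,u)=\sum w(\tau,(m_v))\,z^{|\tau|+\sum_v m_v}\,u^{|\{v\in\tau:\,m_v=m\}|}$, the sum over all structures $(\tau,(m_v)_{v\in\tau})$ described in the context. Then $$T^{[m]}(z,u)=C\bigl(uz\,d_mz^m+z(D(z)-d_mz^m)\bigr).$$ Moreover, the probability that the $D$-forest $F_n(v)$ attached to a random $C$-tree node $v$ of a structure of total size $n$ has size $m$, namely $$\mathbb P\bigl(|F_n(v)|=m\bigr):=\frac{[z^n]\,\partial_uT^{[m]}(z,u)|_{u=1}}{[z^n]\,\partial_u T^{[m]}(z,u)|_{u=1}\text{ summed over all }m}=\frac{\sum_{\text{size }n}w\cdot|\{v:m_v=m\}|}{\sum_{\text{size }n}w\cdot|\tau|},$$ satisfies, as $n\to\infty$, $$\mathbb P\bigl(|F_n(v)|=m\bigr)=\frac{d_m\rho^m}{D(\rho)}\bigl(1+O(n^{-1})\bigr).$$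
   Context: A Pólya tree is a rooted unlabeled tree; its size is its number of vertices. Let $T(z)=\sum_{n\ge1}t_nz^n$, $t_n$ the number of Pólya trees of size $n$, which satisfies $T(z)=z\exp\bigl(\sum_{i\ge1}T(z^i)/i\bigr)$, and let $\rho\approx0.3383$ be its radius of convergence. Let $D(z)=\sum_{n\ge0}d_nz^n=\exp\bigl(\sum_{i\ge2}T(z^i)/i\bigr)$ (weighted generating function of $D$-forests; it is analytic for $|z|<\sqrt\rho$), and $C(z)=\sum_{n\ge1}\frac{n^{n-1}}{n!}z^n$, the solution of $C(z)=ze^{C(z)}$; then $T(z)=C(zD(z))$. A structure is a pair $(\tau,(m_v)_{v\in\tau})$ with $\tau$ a rooted plane (ordered) tree (the $C$-tree, $|\tau|$ its number of vertices) and $m_v\ge0$ integers (the size of the $D$-forest $F_n(v)$ attached at $v$); its total size is $|\tau|+\sum_vm_v$ and its weight is $w(\tau,(m_v))=\prod_{v\in\tau}\frac{d_{m_v}}{\mathrm{outdeg}(v)!}$. The total weight of structures of size $n$ is $t_n$. *)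

(* Defs.v *)
From Stdlib Require List.
From HB Require Import structures.
From mathcomp Require Import all_boot all_order all_algebra.
From mathcomp Require Import finmap.
From mathcomp Require Import all_classical all_reals all_analysis.
Set Implicit Arguments.
Unset Strict Implicit.
Unset Printing Implicit Defensive.
Import Order.TTheory GRing.Theory Num.Theory.
Import numFieldNormedType.Exports.
Local Open Scope classical_set_scope.
Local Open Scope ring_scope.

Inductive ptree : Type := Node of seq ptree.

Fixpoint ptree_encode (t : ptree) : GenTree.tree void :=
  let: Node s := t in GenTree.Node 0 (map ptree_encode s).
Fixpoint ptree_decode (t : GenTree.tree void) : ptree :=
  if t is GenTree.Node _ s then Node (map ptree_decode s) else Node [::].

Lemma ptree_ind' (P : ptree -> Prop) :
  (forall s, (forall t, List.In t s -> P t) -> P (Node s)) -> forall t, P t.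
Proof.
move=> IH; fix f 1; case=> s; apply: IH.
by elim: s => [|x s IHs] t; [case | case=> [<-|]; [exact: f | exact: IHs]].
Qed.

Lemma ptree_encodeK : cancel ptree_encode ptree_decode.
Proof.
elim/ptree_ind' => s IH /=; congr Node; rewrite -map_comp.
elim: s IH => //= x s IHs IH; rewrite IH; last by left.
by rewrite IHs // => t ts; apply: IH; right.
Qed.

HB.instance Definition _ := Countable.copy ptree (can_type ptree_encodeK).

Fixpoint nnodes (t : ptree) : nat :=
  let: Node s := t in (sumn (map nnodes s)).+1.

(* Outdegrees of the nodes, listed in preorder. *)
Fixpoint outdegs (t : ptree) : seq nat :=
  let: Node s := t in size s :: flatten (map outdegs s).

(* Isomorphism of rooted trees, forgetting the order of siblings. *)
Inductive ptree_iso : ptree -> ptree -> Prop :=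
  PtreeIso (s s' r : seq ptree) of
    List.Forall2 ptree_iso s r & perm_eq r s' : ptree_iso (Node s) (Node s').

(* Fuelled enumeration, only used to show that the sets below are finite. *)
Fixpoint seqs_upto (T : Type) (S : seq T) (k : nat) : seq (seq T) :=
  if k is k'.+1 then [::] :: [seq x :: s | x <- S, s <- seqs_upto S k']
  else [:: [::]].

Fixpoint ptrees_upto (k : nat) : seq ptree :=
  if k is k'.+1 then map Node (seqs_upto (ptrees_upto k') k') else [::].

Lemma mem_seqs_upto (T : eqType) (S s : seq T) k :
  (size s <= k)%N -> {subset s <= S} -> s \in seqs_upto S k.
Proof.
elim: k s => [|k IHk] [|x s] //= sk sS; rewrite inE; apply/orP; right.
apply/allpairsP; exists (x, s); split=> //=; first by apply: sS; rewrite mem_head.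
by apply: IHk => // y ys; apply: sS; rewrite inE ys orbT.
Qed.

Lemma nnodes_gt0 t : (0 < nnodes t)%N. Proof. by case: t. Qed.

Lemma mem_ptrees_upto k t : (nnodes t <= k)%N -> t \in ptrees_upto k.
Proof.
elim: k t => [|k IHk] [s] //=; rewrite ltnS => sk; apply: map_f.
apply: mem_seqs_upto => [|t ts].
  apply: leq_trans sk; elim: s => //= x s IHs.
  by rewrite -add1n leq_add ?nnodes_gt0.
apply: IHk; apply: leq_trans sk; elim: s ts => //= x s IHs.
rewrite inE => /orP[/eqP ->|/IHs h]; first exact: leq_addr.
exact: leq_trans h (leq_addl _ _).
Qed.

Lemma finite_ptrees n : finite_set [set t | nnodes t = n].
Proof.
apply: (@sub_finite_set _ _ [set` ptrees_upto n]); last exact: finite_seq.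
by move=> t /= tn; apply: mem_ptrees_upto; rewrite tn.
Qed.

(* Polya trees of size n are the isomorphism classes [ptree_iso t : set ptree]
   of the trees t with n nodes. *)
Definition polya (n : nat) : nat :=
  #|` fset_set [set ptree_iso t | t in [set t | nnodes t = n]] |.

(* A formal power series is the sequence nat -> A of its coefficients. *)
Section FormalPowerSeries.
Variable A : nzRingType.
Implicit Types f g : nat -> A.

Definition fps_trunc (n : nat) f : {poly A} := \poly_(i < n.+1) f i.

(* The composite f(g(z)); meaningful only when g 0 = 0, in which case g(z)^k
   has valuation at least k and the sum may stop at k = n. *)
Definition fps_comp f g : nat -> A :=
  fun n => (\sum_(k < n.+1) f k *: fps_trunc n g ^+ k)`_n.

Definition fps_mulz f : nat -> A := fun n => if n is k.+1 then f k else 0.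

Definition fps_mono (a : A) (m : nat) : nat -> A :=
  fun n => if n == m then a else 0.

End FormalPowerSeries.

Section Series.
Variable R : realType.

Definition T_coef (n : nat) : R := (polya n)%:R.

(* sum_{i >= 2} T(z^i) / i ; since polya 0 = 0, only 2 <= i <= n contribute to
   the coefficient of z^n. *)
Definition logD_coef (n : nat) : R :=
  \sum_(2 <= i < n.+1 | (i %| n)%N) T_coef (n %/ i) / i%:R.

Definition D_coef : nat -> R := fps_comp (fun k => (k`!)%:R^-1) logD_coef.

Definition C_coef (n : nat) : R :=
  if n is k.+1 then (n ^ k)%:R / (n`!)%:R else 0.

(* The supremum is taken in R: this is the radius of convergence when it is
   finite, as for T, whose coefficients are at least 1 from index 1 on. *)
Definition radius (a : nat -> R) : R :=
  sup [set r | 0 <= r /\ cvgn (pseries a r)].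

Definition rho : R := radius T_coef.

Definition D_value (x : R) : R := limn (pseries D_coef x).

(* A structure is a plane tree together with the list of the labels m_v of its
   nodes v, in preorder. *)
Definition structures (n : nat) : set (ptree * seq nat) :=
  [set s | size s.2 = nnodes s.1 /\ (nnodes s.1 + sumn s.2)%N = n].

Lemma finite_structures n : finite_set (structures n).
Proof.
apply: (@sub_finite_set _ _ ([set` ptrees_upto n] `*`
                             [set` seqs_upto (iota 0 n.+1) n])); last first.
  by apply: finite_setX; exact: finite_seq.
move=> [t ms] [/= szm tm]; have tn : (nnodes t <= n)%N by rewrite -tm leq_addr.
split; first exact: mem_ptrees_upto.
apply: mem_seqs_upto => [|x xm]; first by rewrite szm.
rewrite -[_ \in _]/(x \in iota 0 n.+1) mem_iota add0n ltnS -tm; apply: leq_trans (leq_addl _ _).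
elim: ms xm {szm tm} => //= y ms IHm.
rewrite inE => /orP[/eqP ->|/IHm h]; first exact: leq_addr.
exact: leq_trans h (leq_addl _ _).
Qed.

Definition weight (s : ptree * seq nat) : R :=
  \prod_(v < nnodes s.1)
    (D_coef (nth 0%N s.2 v) / ((nth 0%N (outdegs s.1) v)`!)%:R).

(* T^[m](z,u) as a power series in z over R[u] : [Tm m n] is [z^n] T^[m](z,u),
   the polynomial variable being u. *)
Definition Tm (m n : nat) : {poly R} :=
  \sum_(s \in structures n) weight s *: 'X^(count_mem m s.2).

Definition dTm1 (m n : nat) : R := (Tm m n)^`().[1].

(* P(|F_n(v)| = m); for fixed n only finitely many k have [dTm1 k n != 0]. *)
Definition prob_forest (m n : nat) : R :=
  dTm1 m n / \sum_(k \in [set: nat]) dTm1 k n.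

(* The constants d_k and C_k are seen in R[u] through [polyC]. *)
Definition Tm_arg (m : nat) : nat -> {poly R} :=
  let dm := fps_mono (D_coef m)%:P m in
  fps_mulz (fun k => 'X * dm k + ((D_coef k)%:P - dm k)).

End Series.

(* Main.v *)
(* The paper's singularity analysis is replaced by real estimates.
   With [r = rho], the equation [T = z D e^T] and the bound [T e^-T <= 1/e] give
   [r D(r) = 1/e], so that [f_j = e r^j [z^j](z D)] is a probability law, which
   has exponential moments because [D] converges at [sqrt r > r].  As
   [w_k = k^k e^-k / k!] are the coefficients of [1/(1 - C(x/e))], the
   probability at size [n] is [d_m r^m / D(r)] times [beta_(n-m-1) / b_n], where
   [b = sum_k w_k f^k] and [beta = sum_k w_(k+1) f^k].
   Since [w_k] decreases and [k w_k] increases, [b_n] is of the order of [w_n],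
   and [beta_n - b_n = O(w_n / n)].  Finally [(1 - z) b = ((1 - f) b) / G] with
   [G = (1 - f)/(1 - z)], whose coefficients are the tails of [f]; those of index
   [>= 1] add up to at most [r/(1 - r) < 1], so that [1/G] is a Neumann series
   with exponentially small coefficients and [b_n - b_(n-1) = O(w_n / n)]. *)

Require Import Defs.
From HB Require Import structures.
From mathcomp Require Import all_boot all_order all_algebra.
From mathcomp Require Import finmap.
From mathcomp Require Import ring lra zify.
From mathcomp Require Import all_classical all_reals all_analysis.
Set Implicit Arguments.
Unset Strict Implicit.
Unset Printing Implicit Defensive.
Import Order.TTheory GRing.Theory Num.Theory.
Import numFieldNormedType.Exports.
Local Open Scope classical_set_scope.
Local Open Scope ring_scope.

(** The probability is [d_m [z^(n-m-1)] C'(zD)] divided by [[z^n] zD C'(zD)]. Both are sums over the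
    powers of [zD] with almost the same weights, so everything reduces to showing that [b] varies
    slowly, with relative error [O(1/n)]. No estimate is made on a single power [f^k]: with constant
    weights the sum over [k] is the renewal sequence [1/(1 - f)], which stays between [1 - nu] and
    [1] for [nu = r/(1 - r)], and the monotonicity of [w_k] and [k w_k] transfers this to [b]. The
    delicate point is the difference [b_n - b_(n-1)], where [G] must be inverted with control on the
    coefficients. Here this is elementary because [D >= 1] gives [r e <= 1], hence [r < 1/2] and
    [nu < 1]. The equation [T = z D e^T] is itself derived from isomorphism classes: trees become
    sorted canonical forms, and a double count gives the logarithmic derivative of the equation as a
    recurrence between integers. *)

(** * Formal power series *)

(* An alias of [nat -> A], so as to carry the Cauchy product instead of the
   pointwise one. *)
Definition fps (A : nzRingType) : Type := nat -> A.

Section FpsRing.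
Variable A : comNzRingType.
Implicit Types f g h : fps A.

HB.instance Definition _ := GRing.Zmodule.copy (fps A) (nat -> A).

Definition fps_mul f g : fps A := fun n => \sum_(i < n.+1) f i * g (n - i)%N.
Definition fps_one : fps A := fun n => (n == 0%N)%:R.

Lemma coef_fps_trunc n f i : (i <= n)%N -> (fps_trunc n f)`_i = f i.
Proof. by move=> le_in; rewrite coef_poly ltnS le_in. Qed.

(** Up to degree [n] the Cauchy product is a product of polynomials, so the ring axioms that are
    awkward on sums, associativity and commutativity, are inherited from [{poly A}]. *)
Lemma coef_fps_mul (p q : {poly A}) f g n :
  (forall i, (i <= n)%N -> p`_i = f i) -> (forall i, (i <= n)%N -> q`_i = g i) ->
  forall i, (i <= n)%N -> (p * q)`_i = fps_mul f g i.
Proof.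
move=> pf qg i le_in; rewrite coefM; apply: eq_bigr => j _.
by rewrite pf ?qg //; [exact: leq_trans (leq_subr _ _) le_in |
  exact: leq_trans (leq_ord j) le_in].
Qed.

Lemma fps_mulA : associative fps_mul.
Proof.
move=> f g h; apply/funext => n.
have tf := @coef_fps_trunc n f; have tg := @coef_fps_trunc n g.
have th := @coef_fps_trunc n h.
rewrite -(coef_fps_mul tf (coef_fps_mul tg th) (leqnn n)) mulrA.
by rewrite (coef_fps_mul (coef_fps_mul tf tg) th (leqnn n)).
Qed.

Lemma fps_mulC : commutative fps_mul.
Proof.
move=> f g; apply/funext => n.
rewrite -(coef_fps_mul (@coef_fps_trunc n f) (@coef_fps_trunc n g) (leqnn n)).
by rewrite mulrC (coef_fps_mul (@coef_fps_trunc n g) (@coef_fps_trunc n f)).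
Qed.

Lemma fps_mul1 : left_id fps_one fps_mul.
Proof.
move=> f; apply/funext => n; rewrite /fps_mul big_ord_recl /fps_one mul1r subn0.
by rewrite big1 ?addr0 // => i _; rewrite mul0r.
Qed.

Lemma fps_mulDl : left_distributive fps_mul +%R.
Proof.
move=> f g h; apply/funext => n; rewrite /fps_mul/=.
rewrite -[RHS]/(fps_mul f h n + fps_mul g h n) -big_split/=.
by apply: eq_bigr => i _; rewrite -mulrDl.
Qed.

Lemma fps_one_neq0 : fps_one != 0.
Proof. by apply/eqP => /(congr1 (@^~ 0%N))/eqP; rewrite oner_eq0. Qed.

HB.instance Definition _ := GRing.Zmodule_isComNzRing.Build (fps A)
  fps_mulA fps_mulC fps_mul1 fps_mulDl fps_one_neq0.

Lemma fpsME f g n : (f * g) n = \sum_(i < n.+1) f i * g (n - i)%N.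
Proof. by []. Qed.

Lemma fps1E n : (1 : fps A) n = (n == 0%N)%:R. Proof. by []. Qed.
Lemma fpsDE f g n : (f + g) n = f n + g n. Proof. by []. Qed.
Lemma fpsBE f g n : (f - g) n = f n - g n. Proof. by []. Qed.

Lemma fpsM0 f g : (f * g) 0%N = f 0%N * g 0%N.
Proof. by rewrite fpsME big_ord1. Qed.

Lemma fpsMnE f k n : (f *+ k) n = f n *+ k.
Proof. by elim: k => // k IHk; rewrite !mulrS fpsDE IHk. Qed.

Lemma fpsX_coef0 f k : (f ^+ k) 0%N = f 0%N ^+ k.
Proof. by elim: k => [|k IHk]; rewrite ?expr0 // !exprS fpsM0 IHk. Qed.

Lemma fpsX_eq0 f k n : f 0%N = 0 -> (n < k)%N -> (f ^+ k) n = 0.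
Proof.
move=> f0; elim: k n => // k IHk n lt_nk; rewrite exprS fpsME.
apply: big1 => -[[|i] /= lti] _; first by rewrite f0 mul0r.
by rewrite IHk ?mulr0 //; lia.
Qed.

Lemma coef_fps_truncX n f k i : (i <= n)%N -> (fps_trunc n f ^+ k)`_i = (f ^+ k) i.
Proof.
elim: k i => [|k IHk] i le_in; first by rewrite expr0 coef1.
by rewrite !exprS (coef_fps_mul (@coef_fps_trunc n f) IHk).
Qed.

Lemma fps_compE (a f : fps A) n :
  fps_comp a f n = \sum_(k < n.+1) a k * (f ^+ k) n.
Proof.
rewrite /fps_comp coef_sum; apply: eq_bigr => k _.
by rewrite coefZ coef_fps_truncX.
Qed.

Lemma fps_comp_widen (a f : fps A) n N : f 0%N = 0 -> (n < N)%N ->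
  fps_comp a f n = \sum_(k < N) a k * (f ^+ k) n.
Proof.
move=> f0 ltnN; rewrite fps_compE.
rewrite -!(big_mkord xpredT (fun k => a k * (f ^+ k) n)) [RHS](@big_cat_nat _ _ _ n.+1)//=.
rewrite [X in _ + X]big1_seq ?addr0 // => k; rewrite mem_index_iota => /andP[_ /andP[ltnk _]].
by rewrite fpsX_eq0 ?mulr0.
Qed.

(** The Euler operator [z d/dz], a derivation that keeps the index in place. *)
Definition fps_theta f : fps A := fun n => f n *+ n.

Lemma fps_thetaM f g : fps_theta (f * g) = fps_theta f * g + f * fps_theta g.
Proof.
apply/funext => n; rewrite fpsDE !fpsME /fps_theta -big_split -sumrMnl /=.
apply: eq_bigr => i _; rewrite mulrnAl mulrnAr -mulrnDr.
by rewrite subnKC // -ltnS.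
Qed.

Lemma fps_theta1 : fps_theta 1 = 0.
Proof. by apply/funext => -[|n]; rewrite /fps_theta ?mulr0n // fps1E mul0rn. Qed.

Lemma fps_thetaD f g : fps_theta (f + g) = fps_theta f + fps_theta g.
Proof. by apply/funext => n; rewrite /fps_theta fpsDE mulrnDl. Qed.

Lemma fps_thetaX f k : fps_theta (f ^+ k.+1) = (fps_theta f * f ^+ k) *+ k.+1.
Proof.
elim: k => [|k IHk]; first by rewrite expr1 expr0 mulr1.
rewrite exprS fps_thetaM IHk [RHS]mulrS; congr (_ + _).
by rewrite mulrnAr mulrCA exprS.
Qed.

(** Chain rule: the second factor is [a'(f)]. *)
Lemma fps_theta_comp (a f : fps A) : f 0%N = 0 ->
  fps_theta (fps_comp a f) = fps_theta f * fps_comp (fun k => a k.+1 *+ k.+1) f.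
Proof.
move=> f0; apply/funext => n; rewrite /fps_theta fpsME.
rewrite (fps_comp_widen _ f0 (ltnW (ltnSn n.+1))) big_ord_recl expr0 fps1E.
rewrite mulrnDl.
have -> : a (ord0 : 'I_n.+2) * (n == 0%N)%:R *+ n = 0.
  by case: n => [|n]; rewrite ?mulr0n //= mulr0 mul0rn.
rewrite add0r -sumrMnl.
under [RHS]eq_bigr => i _.
  rewrite (fps_comp_widen _ f0 (leq_subr i n : (_ < n.+1)%N)) mulr_sumr.
  over.
rewrite exchange_big /=; apply: eq_bigr => k _ /=.
rewrite -mulrnAr.
have -> : (f ^+ bump 0 k) n *+ n = fps_theta (f ^+ k.+1) n by [].
rewrite fps_thetaX fpsMnE mulrnAr -mulrnAl fpsME mulr_sumr.
by apply: eq_bigr => i _; rewrite mulrCA.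
Qed.

Lemma fps_comp_recl (a f : fps A) : f 0%N = 0 ->
  fps_comp a f = (fun n => if n == 0%N then a 0%N else 0) + f * fps_comp (fun k => a k.+1) f.
Proof.
move=> f0; apply/funext => n; rewrite fpsDE fpsME.
rewrite (fps_comp_widen _ f0 (ltnW (ltnSn n.+1))) big_ord_recl expr0 fps1E.
congr (_ + _); first by case: eqP; rewrite ?mulr1 ?mulr0.
under [RHS]eq_bigr => i _.
  rewrite (fps_comp_widen _ f0 (leq_subr i n : (_ < n.+1)%N)) mulr_sumr.
  over.
rewrite exchange_big /=; apply: eq_bigr => k _ /=.
have -> : (f ^+ bump 0 k) n = (f * f ^+ k) n by rewrite -exprS.
by rewrite fpsME mulr_sumr; apply: eq_bigr => i _; rewrite mulrCA.
Qed.

(** The indeterminate [z]. *)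
Definition fps_shift : fps A := fun n => (n == 1%N)%:R.

Lemma fps_shiftM f : fps_shift * f = fps_mulz f.
Proof.
apply/funext => -[|n]; rewrite fpsME /fps_shift.
  by rewrite big_ord1 mul0r.
rewrite big_ord_recl mul0r add0r big_ord_recl mul1r subn1 big1 ?addr0 // => i _.
by rewrite mul0r.
Qed.

Lemma fps_shiftXM f k n : (fps_shift ^+ k * f) n = if (k <= n)%N then f (n - k)%N else 0.
Proof.
elim: k n => [|k IHk] n; first by rewrite expr0 mul1r subn0.
by rewrite exprS -mulrA fps_shiftM; case: n => //= n; rewrite IHk subSS.
Qed.

End FpsRing.

(** * The exponential series, through linear differential equations *)

Section FpsExp.
Variable K : numFieldType.
Implicit Types f g : fps K.

(** Since [a 0 = 0], the equation reads [n f_n = sum_(i >= 1) a_i f_(n-i)] and determines each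
    coefficient from the earlier ones. Series are thus compared by their logarithmic derivatives. *)
Lemma fps_theta_uniq a f g : fps_theta f = a * f -> fps_theta g = a * g ->
  a 0%N = 0 -> f 0%N = g 0%N -> f = g.
Proof.
move=> af ag a0 fg0; apply/funext; elim/ltn_ind => -[|n] IHn //.
have {af}: fps_theta f n.+1 = (a * f) n.+1 by rewrite af.
have {ag}: fps_theta g n.+1 = (a * g) n.+1 by rewrite ag.
rewrite /fps_theta !fpsME 2![\sum_(i < n.+2) _]big_ord_recl a0 !mul0r !add0r.
have -> : \sum_(i < n.+1) a (lift ord0 i) * g (n.+1 - lift ord0 i)%N =
          \sum_(i < n.+1) a (lift ord0 i) * f (n.+1 - lift ord0 i)%N.
  by apply: eq_bigr => i _; rewrite IHn // lift0 subSS ltnS leq_subr.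
by move=> <-; rewrite -[LHS]mulr_natr -[RHS]mulr_natr; apply: mulIf; rewrite pnatr_eq0.
Qed.

Definition fps_exp f : fps K := fps_comp (fun k => (k`!)%:R^-1) f.

Lemma fps_exp0 f : fps_exp f 0%N = 1.
Proof. by rewrite /fps_exp fps_compE big_ord1 fact0 invr1 mul1r expr0. Qed.

Lemma fps_theta_exp f : f 0%N = 0 -> fps_theta (fps_exp f) = fps_theta f * fps_exp f.
Proof.
move=> f0; rewrite /fps_exp fps_theta_comp //; congr (_ * _); congr (fps_comp _ f).
apply/funext => k; rewrite -[_ *+ k.+1]mulr_natr factS natrM invfM mulrAC mulVf ?mul1r //.
Qed.

(** Both sides have constant term 1 and logarithmic derivative [r theta(f)]. *)
Lemma fps_expX f r : f 0%N = 0 -> fps_exp f ^+ r = fps_exp (f *+ r).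
Proof.
move=> f0; have fr0 : (f *+ r) 0%N = 0 by rewrite fpsMnE f0 mul0rn.
apply: (@fps_theta_uniq (fps_theta (f *+ r))); last 2 first.
  by rewrite /fps_theta mulr0n.
  by rewrite fpsX_coef0 !fps_exp0 expr1n.
case: r fr0 => [|r] _.
  rewrite expr0 fps_theta1 mulr0n mulr1.
  by apply/funext => n; rewrite /fps_theta mul0rn.
rewrite fps_thetaX fps_theta_exp // exprS mulrA -mulrnAl -[(_ * _) *+ _]mulrnAl.
congr (_ * _ * _); apply/funext => n.
by rewrite fpsMnE /fps_theta fpsMnE mulrnAC.
by rewrite fps_theta_exp.
Qed.

End FpsExp.

(** * The Polya equation *)

Section Multisets.
Variables (T : choiceType) (leT : rel T) (sz : T -> nat) (P : pred T).
Hypotheses (leT_total : total leT) (leT_trans : transitive leT).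
Hypotheses (leT_anti : antisymmetric leT) (sz_gt0 : forall x, (0 < sz x)%N).
Variables (objs : nat -> seq T) (msets : nat -> seq (seq T)).
Hypotheses (objs_uniq : forall n, uniq (objs n)).
Hypotheses (msets_uniq : forall n, uniq (msets n)).
Hypothesis mem_objs : forall n x, (x \in objs n) = P x && (sz x == n).
Hypothesis mem_msets : forall n s,
  (s \in msets n) = [&& all P s, sorted leT s & sumn (map sz s) == n].

Local Open Scope nat_scope.
Implicit Types (x : T) (s : seq T).

Lemma sumn_map_block i x s :
  sumn (map sz (nseq i x ++ s)) = i * sz x + sumn (map sz s).
Proof. by rewrite map_cat sumn_cat map_nseq sumn_nseq mulnC. Qed.

Lemma perm_block i x s : i <= count_mem x s ->
  perm_eq (nseq i x ++ (nseq (count_mem x s - i) x ++ seq.filter (predC1 x) s)) s.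
Proof.
move=> le_ic; rewrite catA -nseqD subnKC //.
have -> : nseq (count_mem x s) x = seq.filter (pred1 x) s.
  by rewrite -size_filter; apply/esym/all_pred1P/filter_all.
exact/permPl/perm_filterC.
Qed.

Lemma leq_count_sumn x s : count_mem x s * sz x <= sumn (map sz s).
Proof.
rewrite -(perm_sumn (perm_map sz (perm_block (leqnn (count_mem x s))))).
by rewrite sumn_map_block leq_addr.
Qed.

(** Adding [i] copies of [x] and sorting again is a bijection; its inverse removes [i] copies. *)
Lemma size_msets_block x i n : P x ->
  size [seq s <- msets (i * sz x + n) | i <= count_mem x s] = size (msets n).
Proof.
move=> Px; pose add s := sort leT (nseq i x ++ s).
rewrite -[RHS](size_map add); apply/perm_size/uniq_perm.
- exact: filter_uniq.
- rewrite map_inj_in_uniq // => s s'; rewrite !mem_msets => /and3P[_ ss _] /and3P[_ ss' _].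
  move/(perm_sortP leT_total leT_trans leT_anti); rewrite perm_cat2l.
  exact: (sorted_eq leT_trans leT_anti).
move=> s; rewrite mem_filter; apply/andP/mapP => [[le_ic]|[r]].
  rewrite mem_msets => /and3P[Ps ss /eqP szs].
  set r := nseq (count_mem x s - i) x ++ seq.filter (predC1 x) s.
  have ps : perm_eq (nseq i x ++ sort leT r) s.
    by apply: perm_trans (perm_block le_ic); rewrite perm_cat2l perm_sort.
  exists (sort leT r).
    rewrite mem_msets sort_sorted //= -(eqn_add2l (i * sz x)) -sumn_map_block.
    rewrite (perm_sumn (perm_map sz ps)) szs eqxx andbT.
    by move: Ps; rewrite -(perm_all _ ps) all_cat => /andP[].
  rewrite /add -[LHS](sorted_sort leT_trans ss).
  by apply/(perm_sortP leT_total leT_trans leT_anti); rewrite perm_sym.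
rewrite !mem_msets => /and3P[Pr sr /eqP szr] ->.
have pr : perm_eq (add r) (nseq i x ++ r) by rewrite perm_sort.
split; first by rewrite (permP pr) count_cat count_nseq /= eqxx mul1n leq_addr.
rewrite (perm_all _ pr) all_cat Pr all_nseq Px orbT sort_sorted //=.
by rewrite (perm_sumn (perm_map sz pr)) sumn_map_block szr.
Qed.

Lemma sumn_mset n s : all P s -> all (fun x => sz x <= n) s ->
  sumn (map sz s) = \sum_(d < n.+1) \sum_(x <- objs d) count_mem x s * sz x.
Proof.
elim: s => [|y s IHs] /=; first by rewrite big1 // => d _; rewrite big1.
move=> /andP[Py Ps] /andP[yn sn]; rewrite IHs //.
have -> : sz y = \sum_(d < n.+1) \sum_(x <- objs d) (y == x) * sz x.
  rewrite (bigD1 (Ordinal (yn : sz y < n.+1))) //= [X in _ + X]big1 ?addn0.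
    rewrite (bigD1_seq y) ?mem_objs ?Py ?eqxx //= mul1n big1 ?addn0 // => x.
    by rewrite eq_sym => /negPf ->.
  move=> d /negPf neq; rewrite big1_seq // => x /andP[_]; rewrite mem_objs => /andP[_ /eqP xd].
  case: eqVneq => // yx; case/negP: (negbT neq); apply/eqP/val_inj.
  by rewrite /= -xd yx.
rewrite -big_split /=; apply: eq_bigr => d _; rewrite -big_split /=.
by apply: eq_bigr => x _; rewrite -mulnDl.
Qed.

Lemma sum_leq_minn c n : \sum_(1 <= i < n.+1) (i <= c) = minn n c.
Proof.
elim: n => [|n IHn]; first by rewrite big_nil min0n.
by rewrite big_nat_recr //= IHn; lia.
Qed.

(* Logarithmic derivative of the Euler product, counted twice: the total size
   of all the multisets of size [n] is summed over their elements, an element of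
   multiplicity [c] being seen as [c] blocks of size [i = 1, ..., c]. *)
Lemma msets_rec n : n * size (msets n) = \sum_(d < n.+1) size (objs d) *
  (\sum_(1 <= i < n.+1 | i * d <= n) d * size (msets (n - i * d))).
Proof.
have -> : n * size (msets n) = \sum_(s <- msets n) sumn (map sz s).
  rewrite big_seq (eq_bigr (fun=> n)).
    by rewrite -big_seq big_const_seq count_predT iter_addn_0.
  by move=> s; rewrite mem_msets => /and3P[_ _ /eqP].
have le_sz s x : s \in msets n -> count_mem x s * sz x <= n.
  by rewrite mem_msets => /and3P[_ _ /eqP <-]; exact: leq_count_sumn.
have le_sz1 s : s \in msets n -> all (fun x => sz x <= n) s.
  move=> sn; apply/allP => x; rewrite -has_pred1 has_count => c0.
  by apply: leq_trans (le_sz _ x sn); rewrite leq_pmull.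
rewrite big_seq; under eq_bigr => s sn.
  rewrite (@sumn_mset n); [over | | exact: le_sz1].
  by move: sn; rewrite mem_msets => /and3P[].
rewrite -big_seq exchange_big; apply: eq_bigr => d _ /=; rewrite exchange_big /=.
transitivity (\sum_(x <- objs d) \sum_(1 <= i < n.+1 | i * d <= n) d * size (msets (n - i * d)));
  last by rewrite big_const_seq count_predT iter_addn_0 mulnC.
rewrite big_seq [RHS]big_seq; apply: eq_bigr => x; rewrite mem_objs => /andP[Px /eqP xd].
transitivity (\sum_(s <- msets n) \sum_(1 <= i < n.+1) (i <= count_mem x s) * d).
  rewrite big_seq [RHS]big_seq; apply: eq_bigr => s sn.
  rewrite -big_distrl /= sum_leq_minn xd; congr (_ * _); apply/esym/minn_idPr.
  by apply: leq_trans (le_sz _ x sn); rewrite leq_pmulr.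
rewrite exchange_big /= [RHS]big_mkcond; apply: eq_bigr => i _ /=.
rewrite -big_distrl /= mulnC.
have -> : \sum_(s <- msets n) (i <= count_mem x s) = size [seq s <- msets n | i <= count_mem x s].
  by rewrite size_filter -sum1_count [RHS]big_mkcond; apply: eq_bigr => s _; case: leq.
case: ifPn => [le_idn|]; first by rewrite -(size_msets_block i _ Px) xd subnKC.
rewrite -ltnNge => lt_n; rewrite (_ : seq.filter _ _ = [::]) ?muln0 //.
apply/eqP; rewrite -(negbK (_ == _)) -has_filter; apply/hasPn => s sn.
rewrite -ltnNge; have := le_sz _ x sn; rewrite xd => h.
by have := leq_ltn_trans h lt_n; rewrite ltn_mul2r => /andP[].
Qed.

End Multisets.

(** * Canonical plane representatives of Polya trees *)

Section Canonical.

Definition pickle_le (t t' : ptree) := (choice.pickle t <= choice.pickle t')%N.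

Lemma pickle_le_total : total pickle_le. Proof. by move=> x y; exact: leq_total. Qed.
Lemma pickle_le_trans : transitive pickle_le.
Proof. by move=> y x z; exact: leq_trans. Qed.
Lemma pickle_le_anti : antisymmetric pickle_le.
Proof. by move=> x y /anti_leq /(pcan_inj choice.pickleK). Qed.

(** Siblings are sorted recursively by the code that the countable structure of [ptree] provides,
    which singles out one plane tree in each isomorphism class. *)
Fixpoint canon (t : ptree) : ptree :=
  let: Node s := t in Node (sort pickle_le (map canon s)).

Definition children (t : ptree) : seq ptree := let: Node s := t in s.

Lemma childrenK : cancel children Node. Proof. by case. Qed.

Lemma eq_canon_iso t t' : canon t = canon t' -> ptree_iso t t'.
Proof.
elim/ptree_ind': t t' => s IHs [s'] /= [].
move/(perm_sortP pickle_le_total pickle_le_trans pickle_le_anti) => pss.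
(* The constructor of [ptree_iso] wants a list matching [s] position by position: [s'] is reordered
   so that the canonical forms agree termwise. *)
have {pss} [r rs' rs] : exists2 r, perm_eq r s' & map canon s = map canon r.
  elim: s s' {IHs} pss => [|x s IHs] s' /=.
    by move=> /perm_size/=/esym/eqP; rewrite size_map => /nilP ->; exists [::].
  move=> pss; have /mapP[y ys' xy] : canon x \in map canon s'.
    by rewrite -(perm_mem pss) mem_head.
  have ps' := perm_to_rem ys'.
  have /IHs[r rs' rs] : perm_eq (map canon s) (map canon (rem y s')).
    rewrite -(perm_cons (canon x)) (perm_trans pss) // xy.
    exact: (perm_map canon ps').
  exists (y :: r); last by rewrite /= xy rs.
  by rewrite perm_sym (perm_trans ps') // perm_cons perm_sym.
apply: (@PtreeIso _ _ r) => //.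
elim: s r {s' rs'} rs IHs => [|x s IHs] [|y r] //= [xy rs] IH.
by constructor; [apply: IH => //; left | apply: IHs => // t ts; apply: IH; right].
Qed.

Lemma iso_eq_canon t t' : ptree_iso t t' -> canon t = canon t'.
Proof.
elim/ptree_ind': t t' => s IHs [s'] H.
inversion_clear H as [s1 s2 r sr rs'] => /=.
congr Node; apply/(perm_sortP pickle_le_total pickle_le_trans pickle_le_anti).
suff -> : map canon s = map canon r by exact: perm_map.
elim: sr IHs {rs'} => //= x y {}s {}r xy _ IH IHs.
by rewrite (IHs x _ y xy) ?IH //; [move=> t ts; apply: IHs; right | left].
Qed.

Lemma canonP t t' : ptree_iso t t' <-> canon t = canon t'.
Proof. by split; [exact: iso_eq_canon | exact: eq_canon_iso]. Qed.

Lemma iso_canon t : ptree_iso t (canon t).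
Proof.
elim/ptree_ind': t => s IHs /=; apply: (@PtreeIso _ _ (map canon s)).
  elim: s IHs => //= x s IHs IH; constructor; first by apply: IH; left.
  by apply: IHs => t ts; apply: IH; right.
by rewrite perm_sym perm_sort.
Qed.

Lemma canonK t : canon (canon t) = canon t.
Proof. exact/esym/iso_eq_canon/iso_canon. Qed.

Lemma nnodes_canon t : nnodes (canon t) = nnodes t.
Proof.
elim/ptree_ind': t => s IHs /=; congr S.
rewrite (perm_sumn (perm_map nnodes _ : perm_eq _ (map nnodes (map canon s)))) ?perm_sort//.
elim: s IHs => //= x s IHs IH; rewrite IH ?IHs //; last by left.
by move=> t ts; apply: IH; right.
Qed.

(** This turns canonical trees, with the root removed, into the sorted sequences counted by
    [msets_rec]. *)
Lemma canon_NodeE s : (canon (Node s) == Node s) =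
  all (fun t => canon t == t) s && sorted pickle_le s.
Proof.
apply/eqP/andP => [[h]|[cs ss]] /=.
  split; last by rewrite -h sort_sorted //; exact: pickle_le_total.
  apply/allP => t; rewrite -h mem_sort => /mapP[u _ ->].
  by rewrite canonK.
have -> : map canon s = s.
  by elim: s cs {ss} => //= x s IHs /andP[/eqP -> /IHs ->].
by rewrite sorted_sort //; exact: pickle_le_trans.
Qed.

Definition ctrees n : seq ptree :=
  fset_set [set t | canon t = t /\ nnodes t = n].

Lemma finite_ctrees n : finite_set [set t | canon t = t /\ nnodes t = n].
Proof. by apply: sub_finite_set (finite_ptrees n) => t /= []. Qed.

Lemma mem_ctrees n t : (t \in ctrees n) = (canon t == t) && (nnodes t == n).
Proof.
rewrite in_fset_set; last exact: finite_ctrees.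
apply/idP/andP; first by rewrite inE => -[/eqP ? /eqP].
by move=> [/eqP ? /eqP ?]; rewrite inE.
Qed.

Lemma polyaE n : polya n = size (ctrees n).
Proof.
rewrite /polya /ctrees.
have -> : [set ptree_iso t | t in [set t | nnodes t = n]] =
   (ptree_iso : ptree -> set ptree) @` [set t | canon t = t /\ nnodes t = n].
  apply/seteqP; split=> [_ [t /= tn <-]|_ [t [ct tn] <-]]; last by exists t.
  exists (canon t); first by rewrite /= canonK nnodes_canon.
  by apply/funext => u; apply/propext; rewrite !canonP canonK.
rewrite fset_set_image; last exact: finite_ctrees.
rewrite card_in_imfset //= => t u; rewrite !in_fset_set; try exact: finite_ctrees.
rewrite !inE => -[ct _] [cu _] tu.
rewrite -ct -cu; apply: iso_eq_canon.
have -> : ptree_iso t u = ptree_iso u u by rewrite tu.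
exact: eq_canon_iso.
Qed.

(** A Polya tree of size [n.+1] is a root with a multiset of Polya trees of total size [n], so
    [msets_rec] applies with trees both as objects and, through their children, as multisets. *)
Lemma polya_rec n : (n * polya n.+1 = \sum_(d < n.+1) polya d *
  (\sum_(1 <= i < n.+1 | i * d <= n) d * polya (n - i * d).+1))%N.
Proof.
pose forests k := map children (ctrees k.+1).
have sf k : polya k.+1 = size (forests k) by rewrite polyaE size_map.
rewrite sf (@msets_rec _ pickle_le nnodes (fun t => canon t == t) pickle_le_total
  pickle_le_trans pickle_le_anti nnodes_gt0 ctrees forests).
- by apply: eq_bigr => d _; rewrite polyaE; congr (_ * _)%N; apply: eq_bigr => i _; rewrite sf.
- by move=> k; exact: fset_uniq.
- move=> k; rewrite map_inj_uniq; [exact: fset_uniq|exact: can_inj childrenK].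
- by move=> k t; rewrite mem_ctrees.
move=> k s; rewrite -[s in LHS]/(children (Node s)) mem_map; last exact: can_inj childrenK.
by rewrite mem_ctrees canon_NodeE -andbA.
Qed.

Lemma polya0 : polya 0 = 0%N.
Proof.
rewrite polyaE; apply/eqP; rewrite size_eq0; apply/eqP.
case E : (ctrees 0) => [//|t s]; have : t \in ctrees 0 by rewrite E mem_head.
by rewrite mem_ctrees => /andP[_]; rewrite eqn0Ngt nnodes_gt0.
Qed.

Lemma polya1 : polya 1 = 1%N.
Proof.
rewrite polyaE; suff /perm_size -> : perm_eq (ctrees 1) [:: Node [::]] by [].
apply: uniq_perm => //; first exact: fset_uniq.
move=> t; rewrite mem_ctrees inE; case: t => -[|x s] /=; first by rewrite eqxx.
rewrite andbC; have := nnodes_gt0 x; by case: (nnodes x) => //= n _; apply/esym/eqP.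
Qed.

End Canonical.

(** * The functional equation of [T] *)

Section PolyaEquation.
Variable R : realType.

Lemma sum_multiples (V : nmodType) (F : nat -> V) i N : (0 < i)%N ->
  \sum_(j < N | (i %| j)%N) F j = \sum_(d < N | (i * d < N)%N) F (i * d)%N.
Proof.
move=> i0; transitivity (\sum_(d < N) \sum_(j < N | j == (i * d)%N :> nat) F j).
  rewrite (exchange_big_dep xpredT) //= big_mkcond /=; apply: eq_bigr => j _.
  case: ifPn => [/dvdnP[q jq]|nd].
    have qN : (q < N)%N.
      by apply: leq_ltn_trans (ltn_ord j); rewrite jq leq_pmulr.
    rewrite (big_pred1 (Ordinal qN)) // => d /=.
    by rewrite jq mulnC eqn_pmul2l // eq_sym.
  by rewrite big_pred0 // => d; apply/negbTE; apply: contraNneq nd => ->; exact: dvdn_mulr.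
rewrite [RHS]big_mkcond /=; apply: eq_bigr => d _; case: ifPn => [lt|nlt].
  by rewrite (big_pred1 (Ordinal lt)).
by rewrite big_pred0 // => j; apply/negbTE; apply: contraNneq nlt => <-; exact: ltn_ord.
Qed.

Definition T_fps : fps R := T_coef R.
Definition D_fps : fps R := D_coef R.
Definition logD_fps : fps R := logD_coef R.
(** [T(z)/z], which counts multisets of Polya trees. *)
Definition forest_fps : fps R := fun n => T_fps n.+1.

Lemma T_fps0 : T_fps 0%N = 0. Proof. by rewrite /T_fps /T_coef polya0. Qed.
Lemma logD_fps0 : logD_fps 0%N = 0.
Proof. by rewrite /logD_fps /logD_coef big_geq. Qed.

Lemma theta_logD n : fps_theta logD_fps n =
  \sum_(2 <= i < n.+1 | (i %| n)%N) (n %/ i)%N%:R * T_fps (n %/ i)%N.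
Proof.
case: n => [|n]; first by rewrite /fps_theta mulr0n big_geq.
rewrite /fps_theta /logD_fps /logD_coef -sumrMnl big_nat_cond [RHS]big_nat_cond.
apply: eq_bigr => i /andP[/andP[/ltnW i0 _] /dvdnP[q ->]].
rewrite mulnK // -[_ *+ (q * i)]mulr_natr natrM /T_fps.
by field; rewrite pnatr_eq0 -lt0n.
Qed.

Lemma theta_logT n : fps_theta (T_fps + logD_fps) n =
  \sum_(1 <= i < n.+1 | (i %| n)%N) (n %/ i)%N%:R * T_fps (n %/ i)%N.
Proof.
case: n => [|n]; first by rewrite /fps_theta mulr0n big_geq.
rewrite fps_thetaD fpsDE theta_logD [RHS]big_ltn_cond // dvd1n divn1.
by congr (_ + _); rewrite /fps_theta mulr_natl.
Qed.

(** [polya_rec] read on series: [T + logD] is [sum_(i >= 1) T(z^i)/i], and its Euler derivative at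
    [j] sums [d t_d] over the divisors [d] of [j]. *)
Lemma theta_forest_fps :
  fps_theta forest_fps = fps_theta (T_fps + logD_fps) * forest_fps.
Proof.
apply/funext => n; rewrite fpsME.
have -> : fps_theta forest_fps n = (n * polya n.+1)%:R.
  by rewrite natrM mulr_natl.
rewrite polya_rec.
transitivity (\sum_(1 <= i < n.+1) \sum_(j < n.+1 | (i %| j)%N)
   (j %/ i)%N%:R * T_fps (j %/ i)%N * forest_fps (n - j)%N); last first.
  rewrite (exchange_big_dep xpredT) //=; apply: eq_bigr => j _.
  rewrite -/(fps_theta (T_fps + logD_fps) j) theta_logT big_distrl /=.
  rewrite [LHS](@big_cat_nat _ _ _ j.+1) //= [X in _ + X]big1_seq ?addr0 // => i.
  rewrite mem_index_iota => /and3P[ij ji _].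
  case: (posnP j) ij ji => [->|j0] ij ji; first by rewrite div0n !mul0r.
  by have := dvdn_leq j0 ij; rewrite leqNgt ji.
under [RHS]eq_big_nat => i /andP[i0 _].
  rewrite (sum_multiples (fun j => (j %/ i)%N%:R * T_fps (j %/ i)%N * forest_fps (n - j)%N)) //.
  over.
rewrite natr_sum; under eq_bigr => d _.
  rewrite natrM natr_sum mulr_sumr big_mkcond /=; over.
rewrite exchange_big /= big_nat [RHS]big_nat; apply: eq_bigr => i /andP[i0 _].
rewrite [RHS]big_mkcond; apply: eq_bigr => d _; rewrite ltnS; case: ifP => // _.
by rewrite mulKn // natrM mulrA; congr (_ * _); rewrite mulrC.
Qed.

Lemma D_fpsE : D_fps = fps_exp logD_fps. Proof. by []. Qed.

Lemma theta_D : fps_theta D_fps = fps_theta logD_fps * D_fps.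
Proof. by rewrite D_fpsE fps_theta_exp // logD_fps0. Qed.

(** [D e^T] and [T/z] have the same logarithmic derivative and the same constant term 1. *)
Lemma polya_equation : T_fps = fps_shift R * (D_fps * fps_exp T_fps).
Proof.
have -> : D_fps * fps_exp T_fps = forest_fps.
  apply: (@fps_theta_uniq _ (fps_theta (T_fps + logD_fps))).
  - rewrite fps_thetaM theta_D fps_theta_exp ?T_fps0 // fps_thetaD.
    by ring.
  - exact: theta_forest_fps.
  - by rewrite /fps_theta mulr0n.
  by rewrite fpsM0 D_fpsE !fps_exp0 mulr1 /forest_fps /T_fps /T_coef polya1.
by rewrite fps_shiftM; apply/funext => -[|n] //=; rewrite T_fps0.
Qed.

End PolyaEquation.

(** * Weighted plane trees and structures *)

Section FiniteSums.

Lemma fsum_level (V : nmodType) (T : choiceType) (P : set T) (f : T -> nat) N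
    (F : T -> V) : finite_set P -> (forall x, P x -> (f x < N)%N) ->
  \sum_(x \in P) F x = \sum_(i < N) \sum_(x \in P `&` [set x | f x = i]) F x.
Proof.
move=> finP PN; rewrite fsbig_finite //=.
under [RHS]eq_bigr => i _ do rewrite fsbig_mkcondr fsbig_finite //=.
rewrite exchange_big /= big_seq [RHS]big_seq; apply: eq_bigr => x.
rewrite in_fset_set // inE => Px.
rewrite (bigD1 (Ordinal (PN x Px))) //= mem_set //= big1 ?addr0 // => i ni.
by rewrite memNset //= => fx; case/eqP: ni; apply: val_inj; rewrite /= fx.
Qed.

Variables (A : idomainType) (T : choiceType) (sz : T -> nat) (wt : T -> A).
Hypothesis finite_level : forall n, finite_set [set x | sz x = n].

Definition level_fps : fps A := fun n => \sum_(x \in [set x | sz x = n]) wt x.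

Definition lists_of r n : set (seq T) :=
  [set s | size s = r /\ sumn (map sz s) = n].

Lemma lists_of_cons r n i : (i < n.+1)%N ->
  lists_of r.+1 n `&` [set s | (if s is x :: _ then sz x else 0%N) = i] =
  (fun p => p.1 :: p.2) @` ([set x | sz x = i] `*` lists_of r (n - i)).
Proof.
rewrite ltnS => le_in; apply/seteqP; split=> [[|x s] [[] //= [szs] sums xi]|].
  by exists (x, s) => //; split=> //=; split=> //; rewrite -sums xi addKn.
by move=> _ [[x s] [/= xi [szs sums]] <-]; rewrite /lists_of /= szs sums xi subnKC.
Qed.

Lemma finite_lists_of r n : finite_set (lists_of r n).
Proof.
elim: r n => [|r IHr] n.
  by apply: (@sub_finite_set _ _ [set [::]]) => // s [/eqP/nilP].
apply: (@sub_finite_set _ _ (\bigcup_(i in `I_n.+1)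
   (fun p => p.1 :: p.2) @` ([set x | sz x = i] `*` lists_of r (n - i)))).
  move=> s sn; pose i := if s is x :: _ then sz x else 0%N.
  have lt_in : (i < n.+1)%N.
    by case: s sn @i => [|x s] [_ /= <-] //; rewrite ltnS leq_addr.
  by exists i => //; rewrite -lists_of_cons.
apply: bigcup_finite => // i _; apply: finite_image; apply: finite_setX => //.
Qed.

Lemma fsum_lists_of r n :
  \sum_(s \in lists_of r n) \prod_(x <- s) wt x = (level_fps ^+ r) n.
Proof.
elim: r n => [|r IHr] n.
  rewrite expr0 fps1E; case: eqVneq => [->|n0].
    rewrite (_ : lists_of 0 0 = [set [::]]) ?fsbig_set1 ?big_nil //.
    by apply/seteqP; split=> [s [/eqP/nilP]|_ ->].
  rewrite (_ : lists_of 0 n = set0) ?fsbig_set0 //.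
  by apply/seteqP; split=> // s [/eqP/nilP -> /= /esym/eqP]; rewrite (negPf n0).
rewrite (@fsum_level _ _ _ (fun s => if s is x :: _ then sz x else 0%N) n.+1).
- rewrite exprS fpsME; apply: eq_bigr => i _.
  rewrite lists_of_cons // fsbig_image; last first.
    by move=> [x s] [y s'] _ _ /= [-> ->].
  under eq_fsbigr do rewrite big_cons.
  rewrite -(@pair_fsbig _ _ _ _ _ _ _ (fun x s => wt x * \prod_(y <- s) wt y)) //.
    by under eq_fsbigr do rewrite -mulr_fsumr IHr; rewrite -mulr_fsuml.
  exact: finite_lists_of.
- exact: finite_lists_of.
by move=> [|x s] [_ /= <-] //; rewrite ltnS leq_addr.
Qed.

End FiniteSums.

Lemma fpsMnX (K : comNzRingType) (f : fps K) r j n :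
  ((f *+ r) ^+ j) n = r%:R ^+ j * (f ^+ j) n.
Proof.
elim: j n => [|j IHj] n; first by rewrite !expr0 mul1r.
rewrite !exprS !fpsME mulr_sumr; apply: eq_bigr => i _.
by rewrite fpsMnE IHj -mulr_natl; ring.
Qed.

(** * The tree function [C] as a sum over plane trees *)

Section TreeFunction.
Variable R : realType.

Definition tree_weight (t : ptree) : R := \prod_(o <- outdegs t) (o`!)%:R^-1.

Lemma tree_weight_Node s :
  tree_weight (Node s) = (size s)`!%:R^-1 * \prod_(t <- s) tree_weight t.
Proof. by rewrite /tree_weight /= big_cons big_flatten big_map. Qed.

Definition tree_fps : fps R := level_fps nnodes tree_weight.

Lemma tree_fps0 : tree_fps 0%N = 0.
Proof.
rewrite /tree_fps /level_fps (_ : [set _ | _] = set0) ?fsbig_set0 //.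
by apply/seteqP; split=> // t /= t0; have := nnodes_gt0 t; rewrite t0.
Qed.

(** A plane tree is a root and a list of subtrees; the root of outdegree [r] contributes [1/r!],
    which is the exponential coefficient of the [r]-th power. *)
Lemma tree_fpsE : tree_fps = fps_shift R * fps_exp tree_fps.
Proof.
rewrite fps_shiftM; apply/funext => -[|n]; first by rewrite tree_fps0.
rewrite {1}/tree_fps {1}/level_fps /fps_mulz /fps_exp fps_compE.
have -> : [set t | nnodes t = n.+1] = Node @` [set s | sumn (map nnodes s) = n].
  apply/seteqP; split=> [[s] /= [sn]|_ [s /= <-] <-] //.
  by exists s.
have le_size s : (size s <= sumn (map nnodes s))%N.
  by elim: s => //= x s IHs; rewrite -add1n leq_add ?nnodes_gt0.
rewrite fsbig_image; last by move=> s s' _ _ [].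
rewrite (@fsum_level _ _ _ size n.+1).
- apply: eq_bigr => r _; rewrite -(fsum_lists_of _ finite_ptrees) mulr_fsumr.
  rewrite (_ : _ `&` _ = lists_of nnodes r n).
    by apply: eq_fsbigr => s; rewrite inE => -[sr _]; rewrite tree_weight_Node sr.
  by apply/seteqP; split=> s [].
- apply: (@sub_finite_set _ _ (\bigcup_(r in `I_n.+1) lists_of nnodes r n)).
    by move=> s /= sn; exists (size s) => //=; rewrite ltnS -sn.
  by apply: bigcup_finite => // r _; apply: finite_lists_of => k; exact: finite_ptrees.
by move=> s /= <-; rewrite ltnS.
Qed.

(* From [tau = z e^tau], [[z^n] tau^r = [z^(n-r)] e^(r tau)] involves only
   coefficients of lower index: Lagrange inversion by the binomial theorem. *)
Lemma tree_fpsX n r : (0 < n)%N -> (r <= n)%N ->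
  (tree_fps ^+ r) n = r%:R * n%:R ^+ (n - r) / (n%:R * (n - r)`!%:R).
Proof.
elim/ltn_ind: n r => n IHn [|r] n0 rn; first by rewrite expr0 fps1E gtn_eqF // !mul0r.
rewrite {1}tree_fpsE exprMn fps_shiftXM rn fps_expX ?tree_fps0 //.
rewrite /fps_exp fps_compE; have := subnK rn; set N := (n - r.+1)%N => Nr.
have nn0 : n%:R != 0 :> R by rewrite pnatr_eq0 -lt0n.
case: (posnP N) => [N0|Npos].
  have rn1 : r.+1 = n by lia.
  rewrite N0 big_ord1 fact0 invr1 [_ ^+ ord0]expr0 fps1E eqxx rn1 expr0 !mulr1.
  by rewrite divff.
have powE j : ((tree_fps *+ r.+1) ^+ j) N = r.+1%:R ^+ j * (tree_fps ^+ j) N.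
  exact: fpsMnX.
have coefE (j : 'I_N.+1) :
    (tree_fps ^+ j) N = j%:R * N%:R ^+ (N - j) / (N%:R * (N - j)`!%:R).
  by apply: IHn; have := leq_ord j; lia.
under eq_bigr => j _ do rewrite powE coefE.
rewrite big_ord_recl !mul0r !mulr0 add0r.
have NN0 : N%:R != 0 :> R by rewrite pnatr_eq0 -lt0n.
clear powE coefE; move: N Npos Nr NN0 => [//|N] _ Nr NN0.
have -> : n%:R = N.+1%:R + r.+1%:R :> R by rewrite -natrD Nr.
rewrite exprS invfM.
have nr0 : N.+1%:R + r.+1%:R != 0 :> R by rewrite -natrD Nr.
have -> : r.+1%:R * ((N.+1%:R + r.+1%:R) * (N.+1%:R + r.+1%:R) ^+ N) *
   ((N.+1%:R + r.+1%:R)^-1 * (N.+1)`!%:R^-1) =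
   (r.+1%:R * (N.+1)`!%:R^-1) * (N.+1%:R + r.+1%:R) ^+ N :> R.
  have : (N.+1)`!%:R != 0 :> R by rewrite pnatr_eq0 -lt0n fact_gt0.
  move: (N.+1)`!%:R (N.+1%:R + r.+1%:R) nr0 => z x x0 z0.
  by field; rewrite x0 z0.
(* The term of exponent [i + 1] in the exponential matches the [i]-th term in the binomial expansion
   of [(N.+1 + r.+1)^N]. *)
rewrite exprDn mulr_sumr; apply: eq_bigr => i _.
rewrite lift0 subSS factS [in RHS]factS -(bin_fact (leq_ord i)) !natrM -mulr_natr.
rewrite exprS; field.
by rewrite !nat1r !pnatr_eq0 -!lt0n !fact_gt0 bin_gt0 leq_ord.
Qed.

Lemma tree_fps_coef : tree_fps = C_coef R.
Proof.
apply/funext => -[|n]; first exact: tree_fps0.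
rewrite -[tree_fps]expr1 tree_fpsX // subSS subn0 mul1r /C_coef factS.
by rewrite natrM natrX.
Qed.

End TreeFunction.

(** * The bivariate generating function and its derivative at [u = 1] *)

Section Structures.
Variables (R : realType) (m : nat).

Lemma size_outdegs t : size (outdegs t) = nnodes t.
Proof.
elim/ptree_ind': t => s IHs /=; congr S; rewrite size_flatten /shape -map_comp.
congr sumn; elim: s IHs => //= x s IHs IH; rewrite IH ?IHs //; last by left.
by move=> t ts; apply: IH; right.
Qed.

Lemma weightE t ms : size ms = nnodes t ->
  weight R (t, ms) = tree_weight R t * \prod_(k <- ms) D_coef R k.
Proof.
move=> szm; rewrite /weight /= big_split /= mulrC; congr (_ * _).
  by rewrite /tree_weight (big_nth 0%N) big_mkord size_outdegs.
by rewrite (big_nth 0%N) big_mkord szm.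
Qed.

Definition marked_D_fps : fps {poly R} :=
  fun k => (D_coef R k)%:P * 'X ^+ (k == m).

Lemma Tm_argE : Tm_arg R m = fps_shift {poly R} * marked_D_fps.
Proof.
rewrite fps_shiftM /Tm_arg; congr fps_mulz; apply/funext => k.
rewrite /marked_D_fps /fps_mono; case: eqVneq => [->|_].
  by rewrite subrr addr0 expr1 mulrC.
by rewrite mulr0 add0r subr0 expr0 mulr1.
Qed.

(** Tree and labels are chosen independently once the number [k] of nodes is fixed: the trees sum to
    [C_k], the label lists to the [k]-th power of the marked [D], and the nodes contribute [z^k]. *)
Lemma Tm_fps_comp : Tm R m = fps_comp (fun k => (C_coef R k)%:P) (Tm_arg R m).
Proof.
apply/funext => n; rewrite fps_compE /Tm.
rewrite (@fsum_level _ _ _ (fun s => nnodes s.1) n.+1); last 2 first.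
- exact: finite_structures.
- by move=> s [_ /= <-]; rewrite ltnS leq_addr.
apply: eq_bigr => -[k /=]; rewrite ltnS => le_kn _.
have -> : structures n `&` [set s | nnodes s.1 = k] =
          [set t | nnodes t = k] `*` lists_of id k (n - k).
  apply/seteqP; split=> [[t ms] [[/= szm tn] tk]|[t ms] [/= tk [szm sumk]]].
    by split=> //; split; [rewrite szm|rewrite -tn tk map_id addKn].
  by split=> //; rewrite /structures /= tk szm -(map_id ms) sumk subnKC.
transitivity (\sum_(p \in [set t | nnodes t = k] `*` lists_of id k (n - k))
   (tree_weight R p.1)%:P * \prod_(j <- p.2) marked_D_fps j).
  apply: eq_fsbigr => -[t ms]; rewrite inE => -[/= tk [szm _]].
  rewrite weightE ?tk // /marked_D_fps big_split /= -rmorph_prod /= mulrA -polyCM.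
  rewrite -mul_polyC; congr (_ * _); elim: ms {szm} => [|x ms IH]; rewrite ?big_nil ?big_cons //=.
  by rewrite -IH exprD.
have finl (r : nat) : finite_set [set x : nat | id x = r] by rewrite (_ : [set _ | _] = [set r]).
rewrite -(@pair_fsbig _ _ _ _ _ _ _ (fun t ms => (tree_weight R t)%:P * \prod_(j <- ms) marked_D_fps j)); last 2 first.
- exact: finite_ptrees.
- exact: finite_lists_of.
under eq_fsbigr do rewrite -mulr_fsumr (fsum_lists_of _ finl).
rewrite -mulr_fsuml; congr (_ * _).
  rewrite -tree_fps_coef /tree_fps /level_fps !fsbig_finite ?rmorph_sum //; exact: finite_ptrees.
have -> : level_fps id marked_D_fps = marked_D_fps.
  apply/funext => j.
  by rewrite /level_fps (_ : [set _ | _] = [set j]) ?fsbig_set1.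
by rewrite Tm_argE exprMn fps_shiftXM le_kn.
Qed.

Lemma dTm1E n :
  dTm1 R m n = \sum_(s \in structures n) weight R s * (count_mem m s.2)%:R.
Proof.
rewrite /dTm1 /Tm !fsbig_finite; try exact: finite_structures.
rewrite raddf_sum horner_sum; apply: eq_bigr => s _ /=.
by rewrite derivZ derivXn hornerZ hornerMn hornerXn expr1n.
Qed.

Definition horner1 (f : fps {poly R}) : fps R := fun n => (f n).[1].
Definition deriv1 (f : fps {poly R}) : fps R := fun n => (f n)^`().[1].

Lemma horner1X f k : horner1 (f ^+ k) = horner1 f ^+ k.
Proof.
elim: k => [|k IHk]; first by apply/funext => -[|n]; rewrite /horner1 !expr0 !fps1E hornerC.
apply/funext => n; rewrite !exprS -IHk /horner1 !fpsME horner_sum.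
by apply: eq_bigr => i _; rewrite hornerM.
Qed.

Lemma deriv1X f k : deriv1 (f ^+ k.+1) = (horner1 f ^+ k * deriv1 f) *+ k.+1.
Proof.
elim: k => [|k IHk]; first by rewrite expr1 expr0 mul1r.
have -> : deriv1 (f ^+ k.+2) = deriv1 f * horner1 (f ^+ k.+1) + horner1 f * deriv1 (f ^+ k.+1).
  apply/funext => n; rewrite exprS fpsDE /deriv1 /horner1 !fpsME raddf_sum horner_sum.
  rewrite -big_split /=; apply: eq_bigr => i _.
  by rewrite derivM hornerD !hornerM.
rewrite IHk horner1X [RHS]mulrS mulrC; congr (_ + _).
by rewrite mulrnAr mulrA exprS.
Qed.

(* [C'(z D(z))] *)
Definition dC_fps : fps R :=
  fps_comp (fun k => C_coef R k.+1 * k.+1%:R) (fps_shift R * D_fps R : fps R).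

Lemma shift_D0 : (fps_shift R * D_fps R) 0%N = 0.
Proof. by rewrite fps_shiftM. Qed.

(** At [u = 1] the chain rule gives [d_m z^(m+1) C'(zD)]. *)
Lemma dTm1_coef n :
  dTm1 R m n = if (m < n)%N then D_coef R m * dC_fps (n - m.+1)%N else 0.
Proof.
pose f : fps {poly R} := Tm_arg R m.
have fE : f = fps_shift {poly R} * marked_D_fps by exact: Tm_argE.
have -> : dTm1 R m n = \sum_(k < n.+1) C_coef R k * deriv1 (f ^+ k) n.
  rewrite /dTm1 Tm_fps_comp fps_compE raddf_sum horner_sum; apply: eq_bigr => k _.
  by rewrite /= mul_polyC derivZ hornerZ.
have h1 : horner1 (f) = fps_shift R * D_fps R.
  rewrite fE !fps_shiftM; apply/funext => -[|k]; rewrite /horner1 /=; first by rewrite horner0.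
  by rewrite /marked_D_fps hornerM hornerC hornerXn expr1n mulr1.
have d1 : deriv1 (f) = fps_shift R ^+ m.+1 * (fun k => if k == 0%N then D_coef R m else 0 : R).
  apply/funext => k; rewrite fps_shiftXM fE fps_shiftM /deriv1.
  case: k => [|k]; first by rewrite raddf0 horner0.
  rewrite /= /marked_D_fps subSS mul_polyC derivZ hornerZ ltnS subn_eq0.
  case: eqVneq => [->|km]; first by rewrite leqnn expr1 derivX hornerC mulr1.
  rewrite expr0 derivC horner0 mulr0; case: leqP => // mk; case: leqP => // km'.
  by case/eqP: km; apply/eqP; rewrite eqn_leq mk km'.
have coefE k : (horner1 (f) ^+ k * deriv1 (f)) n =
    if (m < n)%N then D_coef R m * ((fps_shift R * D_fps R) ^+ k) (n - m.+1)%N else 0.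
  rewrite h1 d1 mulrCA fps_shiftXM; case: ifP => // _.
  rewrite mulrC fpsME big_ord_recl subn0 big1 ?addr0 //= => i _.
  by rewrite mul0r.
rewrite big_ord_recl mul0r add0r.
under eq_bigr => k _ do rewrite lift0 deriv1X fpsMnE coefE.
case: ifP => mn; last by rewrite big1 // => k _; rewrite mul0rn mulr0.
rewrite /dC_fps (@fps_comp_widen _ _ _ _ n shift_D0); last by lia.
rewrite mulr_sumr; apply: eq_bigr => k _.
by rewrite -mulr_natr; ring.
Qed.

End Structures.

(** * The sum over all label values *)

Section Denominator.
Variable R : realType.

(** A label is smaller than the total size, so the support is finite; a sum over [[set: nat]] with
    infinite support would be 0 by default. *)
Lemma sum_dTm1 n : \sum_(k \in [set: nat]) dTm1 R k n = \sum_(k < n) dTm1 R k n.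
Proof.
rewrite [RHS](@fsbig_ord _ _ _ n (fun k => dTm1 R k n)); apply/esym/fsbig_widen => // k [_ /=].
by rewrite /preimage /= dTm1_coef => /negP; rewrite -leqNgt ltnNge => ->.
Qed.

(** Every node carries exactly one label, so the counts over all labels add up to the number of
    nodes. *)
Lemma sum_dTm1_nnodes n : \sum_(k \in [set: nat]) dTm1 R k n =
  \sum_(s \in structures n) weight R s * (nnodes s.1)%:R.
Proof.
rewrite sum_dTm1.
have E k : dTm1 R k n = \sum_(s <- fset_set (structures n)) weight R s * (count_mem k s.2)%:R.
  by rewrite dTm1E fsbig_finite //; exact: finite_structures.
under eq_bigr => k _ do rewrite E.
rewrite exchange_big fsbig_finite; last exact: finite_structures.
rewrite big_seq [RHS]big_seq; apply: eq_bigr => -[t ms].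
rewrite in_fset_set; last exact: finite_structures.
rewrite inE => -[/= szm tn]; rewrite -mulr_sumr -szm; congr (_ * _).
rewrite -natr_sum; congr (_%:R).
have le_n x : x \in ms -> (x < n)%N.
  move=> xms; rewrite -tn -add1n leq_add ?nnodes_gt0 //.
  elim: ms xms {szm tn} => //= y ms IH; rewrite inE => /orP[/eqP ->|/IH h]; first exact: leq_addr.
  exact: leq_trans h (leq_addl _ _).
elim: ms le_n {szm tn} => [|x ms IH] le_n; first by rewrite big1.
rewrite /= big_split /= IH; last by move=> y yms; apply: le_n; rewrite inE yms orbT.
rewrite -[RHS]add1n; congr (_ + _)%N; rewrite (bigD1 (Ordinal (le_n x (mem_head _ _)))) //= eqxx big1 // => k kx.
by case: eqVneq => // xk; case/eqP: kx; apply: val_inj.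
Qed.

(* [z D C'(z D)] *)
Lemma sum_dTm1_coef n : (0 < n)%N -> \sum_(k \in [set: nat]) dTm1 R k n =
  fps_comp (fun k => C_coef R k * k%:R) (fps_shift R * D_fps R : fps R) n.
Proof.
move=> n0; rewrite sum_dTm1.
transitivity ((D_fps R * dC_fps R) n.-1).
  rewrite fpsME prednK //; apply: eq_bigr => k _; rewrite dTm1_coef ltn_ord.
  by congr (_ * _); congr (dC_fps R); lia.
rewrite fps_compE big_ord_recl mulr0 mul0r add0r fpsME.
transitivity (\sum_(i < n.-1.+1) \sum_(k < n)
    D_fps R i * (C_coef R k.+1 * k.+1%:R * ((fps_shift R * D_fps R) ^+ k) (n.-1 - i)%N)).
  apply: eq_bigr => i _; rewrite -mulr_sumr; congr (_ * _).
  by rewrite /dC_fps (@fps_comp_widen _ _ _ _ n (shift_D0 R)) //; lia.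
rewrite exchange_big; apply: eq_bigr => k _; rewrite lift0.
have -> : (fps_shift R * D_fps R) ^+ k.+1 = fps_shift R * (D_fps R * (fps_shift R * D_fps R) ^+ k).
  by rewrite exprS mulrA.
have mz g : fps_mulz g n = g n.-1 :> R by case: (n) n0.
rewrite (fps_shiftM (D_fps R * _)) mz fpsME mulr_sumr; apply: eq_bigr => i _.
by ring.
Qed.

End Denominator.

(** * The radius of convergence *)

Section PartialSums.
Variable R : realType.
Implicit Types (f g a : fps R) (x y : R).

Definition psum f x n : R := \sum_(i < n) f i * x ^+ i.
Definition nneg f : Prop := forall n, 0 <= f n.

Lemma psum_pseries f x n : psum f x n = pseries f x n.
Proof. by rewrite /psum /pseries /series /= big_mkord. Qed.

Lemma psumS f x n : psum f x n.+1 = psum f x n + f n * x ^+ n.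
Proof. by rewrite /psum big_ord_recr. Qed.

Lemma psum_ge0 f x n : nneg f -> 0 <= x -> 0 <= psum f x n.
Proof. by move=> f0 x0; apply: sumr_ge0 => i _; rewrite mulr_ge0 ?exprn_ge0. Qed.

Lemma psum_homo f x : nneg f -> 0 <= x -> {homo psum f x : m n / (m <= n)%N >-> m <= n}.
Proof.
move=> f0 x0; apply: homo_leq => [y|y z t|n]; [exact: lexx|exact: le_trans|].
by rewrite psumS lerDl mulr_ge0 ?exprn_ge0.
Qed.

Lemma le_psum f x y n : nneg f -> 0 <= x -> x <= y -> psum f x n <= psum f y n.
Proof.
move=> f0 x0 xy; apply: ler_sum => i _; apply: ler_wpM2l => //.
by apply: lerXn2r; rewrite ?nnegrE // (le_trans x0).
Qed.

Lemma nnegM f g : nneg f -> nneg g -> nneg (f * g).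
Proof. by move=> f0 g0 n; rewrite fpsME sumr_ge0 // => i _; rewrite mulr_ge0. Qed.

Lemma nneg1 : nneg 1. Proof. by move=> n; rewrite fps1E ler0n. Qed.

Lemma nnegX f k : nneg f -> nneg (f ^+ k).
Proof.
move=> f0; elim: k => [|k IHk]; first by rewrite expr0; exact: nneg1.
by rewrite exprS; exact: nnegM.
Qed.

Lemma nneg_comp f g : nneg f -> nneg g -> nneg (fps_comp f g).
Proof.
by move=> f0 g0 n; rewrite fps_compE sumr_ge0 // => k _; rewrite mulr_ge0 // nnegX.
Qed.

Lemma nneg_exp f : nneg f -> nneg (fps_exp f).
Proof. by apply: nneg_comp => n; rewrite invr_ge0 ler0n. Qed.

Lemma psumM_coef f g x n : psum f x n * psum g x n =
  \sum_(k < n + n) (\poly_(i < n) f i * \poly_(i < n) g i)`_k * x ^+ k.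
Proof.
have hE h : psum h x n = (\poly_(i < n) h i).[x] by rewrite horner_poly.
rewrite !hE -hornerM (@horner_coef_wide _ (n + n)) //.
apply: leq_trans (size_polyMleq _ _) _; apply: leq_trans (leq_pred _) _.
by rewrite leq_add // size_poly.
Qed.

(** The square of pairs [i, j < n] lies in the triangle [i + j < 2n]; in [psumM_le] it contains the
    triangle [i + j < n]. *)
Lemma psumM_ge f g x n : nneg f -> nneg g -> 0 <= x ->
  psum f x n * psum g x n <= psum (f * g) x (n + n).
Proof.
move=> f0 g0 x0; rewrite psumM_coef; apply: ler_sum => k _.
rewrite ler_wpM2r ?exprn_ge0 // coefM fpsME; apply: ler_sum => i _.
rewrite !coef_poly; case: ifP => _; last by rewrite mul0r mulr_ge0.
by case: ifP => _; rewrite ?mulr0 ?mulr_ge0.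
Qed.

Lemma psumM_le f g x n : nneg f -> nneg g -> 0 <= x ->
  psum (f * g) x n <= psum f x n * psum g x n.
Proof.
move=> f0 g0 x0; rewrite psumM_coef big_split_ord /= -[leLHS]addr0 lerD //.
  apply: ler_sum => k _; rewrite ler_wpM2r ?exprn_ge0 // coefM fpsME.
  apply: ler_sum => i _; rewrite !coef_poly; have := ltn_ord i; have := ltn_ord k => kn ik.
  by rewrite (leq_trans ik kn) (leq_ltn_trans (leq_subr _ _) kn).
apply: sumr_ge0 => k _; rewrite mulr_ge0 ?exprn_ge0 // coefM sumr_ge0 // => i _.
by rewrite !coef_poly; do 2 case: ifP => _; rewrite ?mulr0 ?mul0r ?mulr_ge0.
Qed.

Lemma psumX_le f x n k : nneg f -> 0 <= x -> (0 < n)%N -> psum (f ^+ k) x n <= psum f x n ^+ k.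
Proof.
move=> f0 x0 n0; elim: k => [|k IHk].
  rewrite !expr0 /psum -(prednK n0) big_ord_recl mulr1 big1 ?addr0 // => i _.
  by rewrite fps1E mul0r.
rewrite !exprS; apply: le_trans (psumM_le _ _ _ _) _ => //; first exact: nnegX.
by rewrite ler_wpM2l ?psum_ge0.
Qed.

(** Each use of [psumM_ge] doubles the range. Starting from [n.+1] keeps at least one term when
    [k = 0]. *)
Lemma psumX_ge f x n k : nneg f -> 0 <= x ->
  psum f x n ^+ k <= psum (f ^+ k) x (n.+1 * 2 ^ k).
Proof.
move=> f0 x0; elim: k => [|k IHk].
  by rewrite !expr0 expn0 muln1 /psum big_ord_recl mulr1 lerDl sumr_ge0 // => i _;
     rewrite fps1E mul0r.
rewrite !exprS expnS mulnCA mul2n -addnn; set N := (n.+1 * 2 ^ k)%N in IHk *.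
apply: le_trans (psumM_ge _ _ _ _) => //; last exact: nnegX.
rewrite ler_pM ?exprn_ge0 ?psum_ge0 //; apply: psum_homo => //.
by rewrite /N (leq_trans (leqnSn n)) // leq_pmulr // expn_gt0.
Qed.

Lemma psum_exp f x n : f 0%N = 0 ->
  psum (fps_exp f) x n = \sum_(k < n) k`!%:R^-1 * psum (f ^+ k) x n.
Proof.
move=> f0; rewrite /psum /fps_exp; under eq_bigr => i _.
  rewrite (fps_comp_widen _ f0 (ltn_ord i)) mulr_suml; over.
rewrite exchange_big; apply: eq_bigr => k _; rewrite mulr_sumr.
by apply: eq_bigr => i _; rewrite mulrA.
Qed.

Lemma sum_exp_coeff_le y n : 0 <= y -> \sum_(k < n) k`!%:R^-1 * y ^+ k <= expR y.
Proof.
move=> y0; have -> : \sum_(k < n) k`!%:R^-1 * y ^+ k = series (exp_coeff y) n.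
  by rewrite /series /= big_mkord; apply: eq_bigr => k _; rewrite mulrC.
apply: nondecreasing_cvgn_le; last exact: is_cvg_series_exp_coeff.
apply/nondecreasing_seqP => k; rewrite /series /= big_nat_recr //= lerDl.
exact: exp_coeff_ge0.
Qed.

Lemma psum_exp_le f x n : nneg f -> f 0%N = 0 -> 0 <= x ->
  psum (fps_exp f) x n <= expR (psum f x n).
Proof.
move=> fp f0 x0; rewrite psum_exp //.
apply: le_trans (sum_exp_coeff_le n (psum_ge0 n fp x0)); apply: ler_sum => k _.
rewrite ler_wpM2l ?invr_ge0 ?ler0n // psumX_le //.
by case: (n) k => [[]|].
Qed.

Lemma psum_exp_ge f x n k : nneg f -> f 0%N = 0 -> 0 <= x ->
  \sum_(j < k) j`!%:R^-1 * psum f x n ^+ j <= psum (fps_exp f) x (n.+1 * 2 ^ k).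
Proof.
move=> fp f0 x0; rewrite psum_exp //; set N := (n.+1 * 2 ^ k)%N.
have kN : (k <= N)%N.
  by rewrite (leq_trans (ltnW (ltn_expl k (ltnSn 1)))) // leq_pmull.
rewrite (big_ord_widen N (fun j => j`!%:R^-1 * psum f x n ^+ j) kN) big_mkcond /=.
apply: ler_sum => j _; case: ifP => jk; last first.
  by rewrite mulr_ge0 ?invr_ge0 ?ler0n // psum_ge0 //; exact: nnegX.
rewrite ler_wpM2l ?invr_ge0 ?ler0n //; apply: le_trans (psumX_ge n j fp x0) _.
apply: psum_homo => //; first exact: nnegX.
by rewrite /N leq_mul2l /= leq_exp2l // ltnW.
Qed.

Lemma psum_shift f x n : psum (fps_shift R * f) x n.+1 = x * psum f x n.
Proof.
rewrite fps_shiftM /psum big_ord_recl mul0r add0r mulr_sumr.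
by apply: eq_bigr => i _; rewrite /= exprS mulrCA.
Qed.

(* Powers are convex, so the partial sums are convex functions of [x]. *)
Lemma psum_right_continuous a y x0 K B B' : nneg a -> 0 <= y -> y < x0 ->
  (forall n, psum a x0 n <= K) -> (forall n, psum a y n <= B) -> B < B' ->
  exists x, [/\ y < x, x <= x0 & forall n, psum a x n <= B'].
Proof.
move=> a0 y0 yx aK aB BB'; have x00 : 0 <= x0 by apply: le_trans (ltW yx).
have K0 : 0 <= K by apply: le_trans (aK 0%N); exact: psum_ge0.
(* The new point divides the segment from [y] to [x0] in ratio [t]; convexity raises the bound by at
   most [t K], which must not exceed [B' - B]. *)
pose t := Num.min 1 ((B' - B) / (K + 1)).
have K1 : 0 < K + 1 by rewrite ltr_wpDl.
have t0 : 0 < t by rewrite lt_min ltr01 divr_gt0 // subr_gt0.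
have t1 : t <= 1 by rewrite ge_min lexx.
have tK : t * K <= B' - B.
  apply: (@le_trans _ _ (t * (K + 1))); first by rewrite ler_pM2l // lerDl.
  by rewrite -ler_pdivlMr // ge_min lexx orbT.
pose x := (1 - t) * y + t * x0.
have convX n : x ^+ n <= (1 - t) * y ^+ n + t * x0 ^+ n.
  elim: n => [|n IHn]; first by rewrite !expr0; lra.
  have h : 0 <= (x0 ^+ n - y ^+ n) * (x0 - y).
    rewrite mulr_ge0 ?subr_ge0 ?(ltW yx) //.
    by apply: lerXn2r; rewrite ?nnegrE // ltW.
  have x_ge0 : 0 <= x by rewrite addr_ge0 ?mulr_ge0 ?subr_ge0 // ltW.
  rewrite !exprS; apply: le_trans (ler_wpM2l x_ge0 IHn) _.
  rewrite -subr_ge0 /x.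
  have -> : (1 - t) * (y * y ^+ n) + t * (x0 * x0 ^+ n) -
    ((1 - t) * y + t * x0) * ((1 - t) * y ^+ n + t * x0 ^+ n) =
    t * (1 - t) * ((x0 ^+ n - y ^+ n) * (x0 - y)) by ring.
  by rewrite mulr_ge0 // mulr_ge0 ?subr_ge0 // ltW.
exists x; split; [rewrite /x; nra|rewrite /x; nra|] => n.
apply: (@le_trans _ _ ((1 - t) * psum a y n + t * psum a x0 n)).
  rewrite !mulr_sumr -big_split; apply: ler_sum => i _ /=.
  by rewrite mulrCA [t * _]mulrCA -mulrDr ler_wpM2l.
have := psum_ge0 n a0 y0; have := aB n; have := aK n; nra.
Qed.

(** Termwise mean value estimate: [i y^(i-1) (x - y) <= x^i - y^i <= x^i]. *)
Lemma psum_theta_le a x y K : nneg a -> 0 <= y -> y < x ->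
  (forall n, psum a x n <= K) -> forall n, psum (fps_theta a) y n <= y * K / (x - y).
Proof.
move=> a0 y0 yx aK n; have xy0 : 0 < x - y by rewrite subr_gt0.
rewrite ler_pdivlMr //; apply: (@le_trans _ _ (y * psum a x n)); last first.
  by rewrite ler_wpM2l.
rewrite mulr_suml mulr_sumr; apply: ler_sum => i _.
rewrite /fps_theta -mulr_natr.
suff h : i%:R * y ^+ i * (x - y) <= y * x ^+ i.
  have -> : a i * i%:R * y ^+ i * (x - y) = a i * (i%:R * y ^+ i * (x - y)) by ring.
  have -> : y * (a i * x ^+ i) = a i * (y * x ^+ i) by ring.
  exact: ler_wpM2l.
elim: (i : nat) => [|k IHk]; first by rewrite !mul0r expr0 mulr1.
have yk : y ^+ k <= x ^+ k by apply: lerXn2r; rewrite ?nnegrE ?(le_trans y0) // ltW.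
have h1 := ler_wpM2l y0 IHk.
have h2 := ler_wpM2l (mulr_ge0 y0 (ltW xy0)) yk.
by rewrite -natr1 !exprS; lra.
Qed.

Lemma cvg_psumP f x : nneg f -> 0 <= x ->
  cvgn (pseries f x) <-> exists B, forall n, psum f x n <= B.
Proof.
move=> f0 x0; have nd : nondecreasing_seq (pseries f x).
  by move=> i j ij; rewrite -!psum_pseries; exact: psum_homo.
split=> [cf|[B fB]].
  by exists (limn (pseries f x)) => n; rewrite psum_pseries; exact: nondecreasing_cvgn_le.
by apply: nondecreasing_is_cvgn => //; exists B => _ [n _ <-]; rewrite -psum_pseries.
Qed.

End PartialSums.

(** * The radius of [T] and the value of [D] there *)

Section Radius.
Variable R : realType.
Implicit Types (x y r : R).

Local Notation T := (T_fps R).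
Local Notation D := (D_fps R).
Local Notation logD := (logD_fps R).
Local Notation e := (expR 1 : R).

Lemma e_gt2 : 2 < e.
Proof. by have := @expR_gt1Dx R 1 (oner_neq0 _); rewrite -[1 + 1]/(2 : R). Qed.

Lemma e_le3 : e <= 3.
Proof.
(* Six is the least [k] for which the bound [(1 - 1/k)^k] on [1/e] reaches [1/3]. *)
have : (5 / 6) ^+ 6 <= expR (- 1) :> R.
  have -> : -1 = 6%:R * (- (1 / 6)) :> R by field.
  rewrite expRM_natl; apply: lerXn2r; rewrite ?nnegrE ?expR_ge0 //.
  by apply: le_trans (expR_ge1Dx _); lra.
rewrite expRN => h; rewrite -[e]invrK -[3]invrK lef_pV2 ?posrE ?invr_gt0 ?expR_gt0 //.
by apply: le_trans h; lra.
Qed.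

Lemma nneg_T : nneg T. Proof. by move=> n; rewrite /T_fps /T_coef ler0n. Qed.
Lemma nneg_logD : nneg logD.
Proof.
by move=> n; apply: sumr_ge0 => i _; rewrite mulr_ge0 ?invr_ge0 ?ler0n.
Qed.
Lemma nneg_D : nneg D. Proof. rewrite D_fpsE; apply: nneg_exp; exact: nneg_logD. Qed.

#[local] Hint Resolve nneg_T nneg_logD nneg_D : core.

Let T0 := T_fps0 R.
Let logD0 := logD_fps0 R.

Lemma D_fps0 : D 0%N = 1. Proof. by rewrite D_fpsE fps_exp0. Qed.

Lemma psumT_S x n : 0 <= x ->
  psum T x n.+1 <= x * (psum D x n * expR (psum T x n)).
Proof.
move=> x0; rewrite {1}polya_equation psum_shift ler_wpM2l //.
apply: le_trans (psumM_le _ nneg_D (nneg_exp nneg_T) x0) _.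
by rewrite ler_wpM2l ?psum_ge0 ?psum_exp_le.
Qed.

(** The recursion [T_(n+1) <= x D e^(T_n)] preserves the bound 1, since [x D e <= 1]. *)
Lemma psumT_le1 x : 0 <= x -> (forall n, x * psum D x n * e <= 1) ->
  forall n, psum T x n <= 1.
Proof.
move=> x0 xD; elim=> [|n IHn]; first by rewrite /psum big_ord0.
apply: le_trans (psumT_S n x0) _; apply: le_trans (xD n).
rewrite mulrA ler_wpM2l ?ler_expR //.
by rewrite mulr_ge0 ?psum_ge0 //; exact: nneg_D.
Qed.

(* [T e^-T <= 1/e] *)
Lemma psumD_le x B : 0 <= x -> (forall n, psum T x n <= B) ->
  forall n, x * psum D x n * e <= 1.
Proof.
move=> x0 TB a; have /(cvg_psumP nneg_T x0) cT : exists B, forall n, psum T x n <= B by exists B.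
set L := limn (pseries T x).
have TL n : psum T x n <= L.
  rewrite psum_pseries; apply: nondecreasing_cvgn_le => // i j ij.
  by rewrite -!psum_pseries; apply: psum_homo => //; exact: nneg_T.
move: x0; rewrite le_eqVlt => /orP[/eqP <-|x0]; first by rewrite !mul0r ler01.
have x0' := ltW x0.
have Dp := nneg_D; have Tp := nneg_T.
have L0 : 0 < L.
  apply: lt_le_trans (TL 2); rewrite /psum !big_ord_recl big_ord0 /= T0 mul0r add0r addr0.
  by rewrite expr1 mulr_gt0 // /T_fps /T_coef polya1 ltr01.
set c := x * psum D x a; have : 0 <= c by rewrite mulr_ge0 ?psum_ge0.
rewrite le_eqVlt => /orP[/eqP <-|c0]; first by rewrite mul0r ler01.
(* For fixed [a], [c exp(T_n) <= L]: once the exponential is truncated, the product is contained in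
   a longer partial sum of [x D e^T = T]. *)
have expT n : expR (psum T x n) <= L / c.
  set y := psum T x n; apply: limr_le; first exact: is_cvg_series_exp_coeff.
  near=> k; rewrite ler_pdivlMr // mulrC.
  have -> : series (exp_coeff y) k = \sum_(j < k) j`!%:R^-1 * y ^+ j.
    by rewrite /series /= big_mkord; apply: eq_bigr => j _; rewrite mulrC.
  apply: le_trans (ler_wpM2l (ltW c0) (psum_exp_ge n k Tp T0 x0')) _.
  set N := (n.+1 * 2 ^ k)%N; pose M := (a + N)%N.
  apply: le_trans (TL (M + M).+1).
  have -> : psum T x (M + M).+1 = x * psum (D * fps_exp T) x (M + M).
    by rewrite {1}polya_equation psum_shift.
  rewrite /c -mulrA ler_wpM2l //.
  apply: le_trans (psumM_ge _ Dp (nneg_exp Tp) x0').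
  by apply: ler_pM; rewrite ?psum_ge0 ?psum_homo // ?leq_addr ?leq_addl //; exact: nneg_exp.
rewrite leNgt; apply/negP => ce1.
have ce0 : 0 < c * e by exact: lt_trans ce1.
suff : L <= L / (c * e) by rewrite ler_pdivlMr // -ler_pdivlMl // mulVf ?gt_eqF // leNgt ce1.
apply: limr_le; first exact: cT; near=> n; rewrite -psum_pseries ler_pdivlMr //.
(* The tangent to the exponential at 1; with [expT] it gives [L <= L / (c e)], which is absurd when
   [c e > 1]. *)
have : e * psum T x n <= expR (psum T x n).
  have -> : expR (psum T x n) = e * expR (psum T x n - 1) by rewrite -expRD addrC subrK.
  by rewrite ler_pM2l ?expR_gt0 //; have := expR_ge1Dx (psum T x n - 1); lra.
by move=> /le_trans/(_ (expT n)); rewrite ler_pdivlMr // => h; rewrite mulrA mulrAC [_ * e]mulrC.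
Unshelve. all: by end_near. Qed.

(** Any bound on the partial sums gives [r D e <= 1], hence the bound 1. This uniform criterion is
    what passes to the supremum [rho]. *)
Lemma cvg_T r : 0 <= r -> cvgn (pseries (T_coef R) r) <-> (forall n, psum T r n <= 1).
Proof.
move=> r0; have cP := cvg_psumP nneg_T r0; split=> [/cP[B TB]|T1].
  by apply: psumT_le1 => //; exact: psumD_le TB.
by apply/cP; exists 1.
Qed.

Lemma psum_dirichlet (G : nat -> nat -> R) x n : (forall d i, 0 <= G d i) -> 0 <= x ->
  \sum_(j < n) (\sum_(2 <= i < j.+1 | (i %| j)%N) G (j %/ i)%N i) * x ^+ j <=
  \sum_(d < n) \sum_(2 <= i < n.+1) G d i * (x ^+ d) ^+ i.
Proof.
move=> G0 x0; have GX0 d i j : 0 <= G d i * x ^+ j by rewrite mulr_ge0 ?exprn_ge0.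
apply: (@le_trans _ _ (\sum_(j < n) \sum_(2 <= i < n.+1 | (i %| j)%N) G (j %/ i)%N i * x ^+ j)).
  apply: ler_sum => j _; rewrite mulr_suml.
  case: (leqP 2 j.+1) => j2; last by rewrite big_geq ?sumr_ge0 // ltnW.
  rewrite [leRHS](@big_cat_nat _ _ _ j.+1) //=; last by rewrite ltnS ltnW.
  by rewrite lerDl sumr_ge0.
rewrite (exchange_big_dep xpredT) //= [leRHS]exchange_big /= !big_nat.
apply: ler_sum => i /andP[i2 _]; have i0 : (0 < i)%N by apply: leq_trans i2.
rewrite (sum_multiples (fun j => G (j %/ i)%N i * x ^+ j)) // big_mkcond.
apply: ler_sum => d _; rewrite -exprM; case: ifP => _ //.
by rewrite mulKn // mulnC.
Qed.

Lemma sum_geom_le x n : 0 <= x -> x < 1 -> \sum_(2 <= i < n.+1) x ^+ i <= x ^+ 2 / (1 - x).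
Proof.
move=> x0 x1; have x10 : 0 < 1 - x by rewrite subr_gt0.
suff h : (\sum_(2 <= i < n.+1) x ^+ i) * (1 - x) <= x ^+ 2 by rewrite ler_pdivlMr.
case: n => [|n]; first by rewrite big_geq // mul0r exprn_ge0.
have -> : (\sum_(2 <= i < n.+2) x ^+ i) * (1 - x) = x ^+ 2 - x ^+ n.+2.
  elim: n => [|n IHn]; first by rewrite big_geq // mul0r subrr.
  by rewrite big_nat_recr //= mulrDl IHn [x ^+ n.+3]exprS; ring.
by rewrite gerBl exprn_ge0.
Qed.

(** Only powers [x^(d i)] with [i >= 2] occur, and for each [d] they sum to at most
    [x^(2d)/(1 - x)]. The argument [x^2] is why [D] converges up to [sqrt rho]. *)
Lemma psum_logD_le x n : 0 <= x -> x < 1 -> psum logD x n <= psum T (x ^+ 2) n / (1 - x).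
Proof.
move=> x0 x1; have x10 : 0 < 1 - x by rewrite subr_gt0.
apply: le_trans (@psum_dirichlet (fun d i => T d / i%:R) x n _ x0) _.
  by move=> d i; rewrite mulr_ge0 ?invr_ge0 ?ler0n.
rewrite mulr_suml; apply: ler_sum => d _; case: (posnP d) => [->|d0].
  by rewrite T0 !mul0r big1 // => i _; rewrite !mul0r.
apply: (@le_trans _ _ (\sum_(2 <= i < n.+1) T d * (x ^+ d) ^+ i)).
  rewrite !big_nat; apply: ler_sum => i /andP[i2 _]; rewrite ler_wpM2r ?exprn_ge0 //.
  by rewrite ler_piMr // invf_le1 ?ler1n ?ltr0n; apply: leq_trans i2.
have xd : x ^+ d <= x by rewrite -[leRHS]expr1 ler_wiXn2l // ltW.
have xd1 : x ^+ d < 1 by exact: le_lt_trans x1.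
rewrite -mulr_sumr -mulrA ler_wpM2l //; apply: le_trans (sum_geom_le n _ xd1) _; first exact: exprn_ge0.
rewrite -!exprM mulnC ler_wpM2l ?exprn_ge0 // lef_pV2 ?posrE ?subr_gt0 //.
by rewrite lerD2l lerN2.
Qed.

Lemma psum_theta_logD_le x n : 0 <= x -> x < 1 -> (forall k, psum T x k <= 1) ->
  psum (fps_theta logD) x n <= x / (1 - x).
Proof.
move=> x0 x1 T1; have x10 : 0 < 1 - x by rewrite subr_gt0.
rewrite /psum; under eq_bigr => j _ do rewrite theta_logD.
apply: le_trans (@psum_dirichlet (fun d i => d%:R * T d) x n _ x0) _.
  by move=> d i; rewrite mulr_ge0 ?ler0n.
have c0 : 0 <= x / (1 - x) by rewrite divr_ge0 // ltW.
apply: le_trans (ler_piMr c0 (T1 n)); rewrite mulr_sumr; apply: ler_sum => d _.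
rewrite -mulr_sumr; case: (posnP d) => [->|d0]; first by rewrite T0 !mul0r mulr0.
set y := x ^+ d; have y0 : 0 <= y by exact: exprn_ge0.
have yx : y <= x by rewrite -[leRHS]expr1 ler_wiXn2l // ltW.
have y1 : y < 1 by exact: le_lt_trans x1.
(* That is, [d x^d <= x + x^2 + ... + x^d], multiplied by [1 - x]. *)
have dy : d%:R * y * (1 - x) <= x * (1 - y).
  rewrite /y; elim: (d : nat) => [|k IHk]; first by rewrite !mul0r expr0 subrr mulr0.
  have xk : x ^+ k <= 1 by rewrite exprn_ile1 // ltW.
  have h1 := ler_wpM2l x0 IHk.
  have h2 := ler_wpM2l (mulr_ge0 x0 (ltW x10)) xk.
  by rewrite -natr1 !exprS; lra.
have y10 : 0 < 1 - y by rewrite subr_gt0.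
apply: le_trans (ler_wpM2l _ (sum_geom_le n y0 y1)) _; first by rewrite mulr_ge0 ?ler0n.
have -> : d%:R * T d * (y ^+ 2 / (1 - y)) = (T d * y) * (d%:R * y / (1 - y)) by ring.
rewrite [leRHS]mulrC; apply: ler_wpM2l; first by rewrite mulr_ge0.
by rewrite ler_pdivrMr // mulrAC ler_pdivlMr.
Qed.

(** The bound [3/4] reproduces itself: [T(1/16) <= T(1/4)/4] gives [logD(1/4) <= 1/4], so the next
    partial sum is at most [e^(1/4 + 3/4)/4 = e/4 <= 3/4]. *)
Lemma psumT_quarter n : psum T (1 / 4) n <= 3 / 4.
Proof.
have q0 : 0 <= 1 / 4 :> R by lra.
have q1 : 1 / 4 < 1 :> R by lra.
elim: n => [|n IHn]; first by rewrite /psum big_ord0; lra.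
apply: le_trans (psumT_S n q0) _.
have h : psum logD (1 / 4) n <= 1 / 4.
  apply: le_trans (psum_logD_le n q0 q1) _.
  have : psum T ((1 / 4) ^+ 2) n <= 1 / 4 * psum T (1 / 4) n.
    rewrite mulr_sumr; apply: ler_sum => -[[|i] /= _] _; first by rewrite T0 !mul0r mulr0.
    rewrite mulrCA ler_wpM2l // -exprM mulnC exprM.
    have z0 : 0 <= (1 / 4 : R) ^+ i.+1 by exact: exprn_ge0.
    rewrite expr2 ler_wpM2r // exprS ler_piMr // exprn_ile1 //; lra.
  by move=> h; rewrite ler_pdivrMr; lra.
have hD : psum D (1 / 4) n <= expR (1 / 4).
  rewrite D_fpsE; apply: le_trans (psum_exp_le n nneg_logD logD0 q0) _.
  by rewrite ler_expR.
have hT : expR (psum T (1 / 4) n) <= expR (3 / 4) by rewrite ler_expR.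
have : psum D (1 / 4) n * expR (psum T (1 / 4) n) <= expR (1 / 4) * expR (3 / 4).
  by apply: ler_pM; rewrite ?psum_ge0 ?expR_ge0.
rewrite -expRD (_ : 1 / 4 + 3 / 4 = 1); last lra.
by have := e_le3; lra.
Qed.

Lemma psumT_le1_mul_e r : 0 <= r -> (forall n, psum T r n <= 1) -> r * e <= 1.
Proof.
move=> r0 T1; have := psumD_le r0 T1 1.
by rewrite /psum big_ord1 D_fps0 !mulr1.
Qed.

Lemma has_sup_rho : has_sup [set r : R | 0 <= r /\ cvgn (pseries (T_coef R) r)].
Proof.
split.
  exists (1 / 4); split; first lra.
  by apply/cvg_T => [|n]; [lra | have := psumT_quarter n; lra].
exists 1 => r /= [r0 /(cvg_T r0)/(psumT_le1_mul_e r0) re].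
by apply: le_trans re; rewrite ler_peMr //; have := e_gt2; lra.
Qed.

Lemma rho_ge_quarter : 1 / 4 <= rho R.
Proof.
apply: sup_upper_bound has_sup_rho _ _; split; first lra.
by apply/cvg_T => [|n]; [lra | have := psumT_quarter n; lra].
Qed.

(** The bound holds at [t rho] for [t < 1], where the partial sum is at least [t^n] times the one at
    [rho]; then [t] is taken close to 1. *)
Lemma psumT_rho n : psum T (rho R) n <= 1.
Proof.
have rho0 : 0 < rho R by have := rho_ge_quarter; lra.
have lt_rho t : 0 <= t -> t < 1 -> psum T (t * rho R) n <= 1.
  move=> t0 t1; have d0 : 0 < rho R - t * rho R by rewrite subr_gt0 gtr_pMl.
  have [r /= [r0 cr]] := sup_adherent d0 has_sup_rho.
  rewrite -/(radius _) -/(rho R) opprB addrC subrK => /ltW tr.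
  have /(cvg_T r0)/(_ n) := cr; apply: le_trans; apply: le_psum => //.
  by rewrite mulr_ge0 // ltW.
have geom t : 0 <= t -> t < 1 -> t ^+ n * psum T (rho R) n <= 1.
  move=> t0 t1; apply: le_trans (lt_rho t t0 t1); rewrite mulr_sumr; apply: ler_sum => i _.
  rewrite exprMn mulrCA ler_wpM2l // ler_wpM2r //; first by rewrite exprn_ge0 // ltW.
  by apply: ler_wiXn2l => //; [exact: ltW | exact: ltnW].
set P := psum T (rho R) n in geom *.
rewrite leNgt; apply/negP => P1.
(* Chosen so that [n s P < P - 1]; by Bernoulli's inequality [(1 - s)^n P > 1], a contradiction. *)
pose s := (P - 1) / (P * n.+1%:R).
have P0 : 0 < P by exact: lt_trans P1.
have n0 : 0 < n.+1%:R :> R by rewrite ltr0n.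
have s0 : 0 < s by rewrite divr_gt0 ?mulr_gt0 ?subr_gt0.
have s1 : s <= 1.
  rewrite ler_pdivrMr ?mulr_gt0 // mul1r; apply: (@le_trans _ _ P); first lra.
  by rewrite ler_peMr ?ler1n // ltW.
have bern : 1 - n%:R * s <= (1 - s) ^+ n.
  elim: (n) => [|k IHk]; first by rewrite mul0r subr0 expr0.
  have k0 : 0 <= k%:R :> R by rewrite ler0n.
  rewrite exprS -natr1; have h : 0 <= 1 - s by lra.
  by have := ler_wpM2l h IHk; have := mulr_ge0 k0 (mulr_ge0 (ltW s0) (ltW s0)); lra.
have := geom (1 - s); rewrite subr_ge0 s1 ltrBlDr ltrDl s0 => /(_ isT isT) h.
have h2 : (1 - n%:R * s) * P <= 1 by apply: le_trans h; rewrite ler_wpM2r // ltW.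
have h3 : s * P * n.+1%:R = P - 1 by rewrite /s; field; rewrite ?pnatr_eq0 ?gt_eqF.
by move: h3; rewrite -natr1; have := mulr_gt0 s0 P0; lra.
Qed.

Lemma rho_lt_half : rho R < 1 / 2.
Proof.
have r0 : 0 <= rho R by have := rho_ge_quarter; lra.
have := psumT_le1_mul_e r0 psumT_rho; have := e_gt2; have := rho_ge_quarter; nra.
Qed.

Lemma rho_max r : 0 <= r -> (forall n, psum T r n <= 1) -> r <= rho R.
Proof. by move=> r0 T1; apply: sup_upper_bound has_sup_rho _ _; split=> //; apply/cvg_T. Qed.

Lemma psumD_rho n : rho R * psum D (rho R) n * e <= 1.
Proof. by apply: psumD_le psumT_rho _; have := rho_ge_quarter; lra. Qed.

Lemma psumD_sqrt_rho n : psum D (Num.sqrt (rho R)) n <= expR (1 / (1 - Num.sqrt (rho R))).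
Proof.
have r0 : 0 <= rho R by have := rho_ge_quarter; lra.
have s1 : Num.sqrt (rho R) < 1.
  by rewrite -sqrtr1 ltr_sqrt //; have := rho_lt_half; lra.
rewrite D_fpsE; apply: le_trans (psum_exp_le n nneg_logD logD0 (sqrtr_ge0 _)) _.
rewrite ler_expR; apply: le_trans (psum_logD_le n (sqrtr_ge0 _) s1) _.
by rewrite sqr_sqrtr // ler_wpM2r ?psumT_rho // invr_ge0 subr_ge0 ltW.
Qed.

Lemma rho_lt_sqrt : rho R < Num.sqrt (rho R).
Proof.
have := rho_ge_quarter; have := rho_lt_half => r1 r0.
have s0 : 0 < Num.sqrt (rho R) by rewrite sqrtr_gt0; lra.
have : Num.sqrt (rho R) * Num.sqrt (rho R) = rho R by rewrite -expr2 sqr_sqrtr //; lra.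
by nra.
Qed.

Lemma cvg_D : cvgn (pseries D (rho R)).
Proof.
have r0 : 0 < rho R by have := rho_ge_quarter; lra.
apply/cvg_psumP => //; first exact: ltW.
exists (1 / (rho R * e)) => n; rewrite ler_pdivlMr ?mulr_gt0 ?expR_gt0 //.
by have := psumD_rho n; lra.
Qed.

(* If [rho D(rho) < 1/e], then [x D(x) <= 1/e] for some [x > rho], where the
   series [T] would still converge. *)
Lemma D_rho : rho R * D_value (rho R) * e = 1.
Proof.
have r0 : 0 < rho R by have := rho_ge_quarter; lra.
have r0' := ltW r0; have e0 : 0 < e by exact: expR_gt0.
have cD := cvg_D.
have DL n : psum D (rho R) n <= D_value (rho R).
  rewrite psum_pseries; apply: nondecreasing_cvgn_le => // i j ij.
  by rewrite -!psum_pseries; apply: psum_homo.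
have D_le : D_value (rho R) <= 1 / (rho R * e).
  apply: limr_le => //; near=> n; rewrite -psum_pseries ler_pdivlMr ?mulr_gt0 //.
  by have := psumD_rho n; lra.
apply/eqP; rewrite eq_le; apply/andP; split.
  by move: D_le; rewrite ler_pdivlMr ?mulr_gt0 //; lra.
rewrite leNgt; apply/negP => D1.
have shift_nneg : nneg (fps_shift R * D) by apply: nnegM => // k; rewrite ler0n.
have shift_le x B : 0 <= B -> (forall n, x * psum D x n <= B) -> forall n, psum (fps_shift R * D) x n <= B.
  by move=> B0 xB [|n]; [rewrite /psum big_ord0|rewrite psum_shift].
have [|||x [rx _ xD]] := @psum_right_continuous _ (fps_shift R * D) (rho R) (Num.sqrt (rho R))
   (Num.sqrt (rho R) * expR (1 / (1 - Num.sqrt (rho R)))) (rho R * D_value (rho R)) e^-1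
   shift_nneg r0' rho_lt_sqrt.
- apply: shift_le => [|n]; first by rewrite mulr_ge0 ?sqrtr_ge0 ?expR_ge0.
  by rewrite ler_wpM2l ?sqrtr_ge0 ?psumD_sqrt_rho.
- apply: shift_le => [|n]; last by rewrite ler_wpM2l.
  by rewrite mulr_ge0 //; apply: le_trans (DL 0%N); exact: psum_ge0.
- by rewrite -div1r ltr_pdivlMr.
have x0 : 0 <= x by apply: le_trans (ltW rx).
suff : x <= rho R by rewrite leNgt rx.
apply: rho_max => //; apply: psumT_le1 => // n.
by rewrite -ler_pdivlMr // div1r -psum_shift.
Unshelve. all: by end_near. Qed.

End Radius.

(** * Boltzmann sums over a renewal sequence *)

(** In convolutions this trades [1/(n-i+1)] for [(i+1)/(n+1)]; the factors [i+1] are absorbed by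
    moments. *)
Lemma leq_mul_subS i n : (i <= n)%N -> (n.+1 <= i.+1 * (n - i).+1)%N.
Proof.
by move=> le_in; nia.
Qed.

Lemma leq_mul_sub j n : (j < n)%N -> (n <= j.+1 * (n - j))%N.
Proof. by case: n => // n; rewrite ltnS => jn; rewrite subSn // leq_mul_subS. Qed.

(** * The weights [k^k e^-k / k!] *)

Section StirlingWeights.
Variable R : realType.

(* The coefficients of [1/(1 - C(x/e))]. *)
Definition wgt (k : nat) : R := k%:R ^+ k * expR (- k%:R) / k`!%:R.

Lemma wgt0 : wgt 0 = 1.
Proof. by rewrite /wgt expr0 oppr0 expR0 fact0 divr1 mulr1. Qed.

Lemma wgt1 : wgt 1 = (expR 1)^-1.
Proof. by rewrite /wgt expr1 mul1r divr1 expRN. Qed.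

Lemma fact_gt0R k : 0 < k`!%:R :> R. Proof. by rewrite ltr0n fact_gt0. Qed.

Lemma wgt_ge0 k : 0 <= wgt k.
Proof. by rewrite divr_ge0 ?mulr_ge0 ?exprn_ge0 ?expR_ge0 ?ler0n. Qed.

Lemma wgtS k : wgt k.+1 = k.+1%:R ^+ k * expR (- 1) * (expR (- k%:R) / k`!%:R).
Proof.
have kn0 : k.+1%:R != 0 :> R by rewrite pnatr_eq0.
have fn0 : k`!%:R != 0 :> R by rewrite gt_eqF ?fact_gt0R.
rewrite /wgt factS natrM exprS.
have -> : - k.+1%:R = -1 + - k%:R :> R by rewrite -natr1; ring.
rewrite expRD; move: (k.+1%:R) (k`!%:R) kn0 fn0 => x y x0 y0.
by field; rewrite y0 x0.
Qed.

(** Amounts to [(1 + 1/k)^k <= e]. *)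
Lemma wgt_decrS k : wgt k.+1 <= wgt k.
Proof.
rewrite wgtS /wgt -[leRHS]mulrA ler_wpM2r ?divr_ge0 ?expR_ge0 ?ler0n //.
rewrite expRN ler_pdivrMr ?expR_gt0 //.
case: k => [|k]; first by rewrite !expr0 mul1r -[leLHS]expR0 ler_expR.
have k0 : 0 < k.+1%:R :> R by rewrite ltr0n.
have -> : expR 1 = expR (k.+1%:R^-1) ^+ k.+1 :> R by rewrite -expRM_natl divff ?gt_eqF.
rewrite -exprMn; apply: lerXn2r; rewrite ?nnegrE ?mulr_ge0 ?expR_ge0 ?ler0n //.
apply: le_trans (ler_wpM2l (ltW k0) (expR_ge1Dx _)).
by rewrite mulrDr mulr1 divff ?gt_eqF // natr1.
Qed.

Lemma wgt_decr : {homo wgt : m n / (m <= n)%N >-> n <= m}.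
Proof.
move=> m n /subnK <-; elim: (n - m)%N => [|j IHj]; first by rewrite add0n.
by rewrite addSn (le_trans (wgt_decrS _)).
Qed.

(** Amounts to [(1 - 1/(k+1))^(k+1) <= 1/e]. *)
Lemma mul_wgt_incrS k : k%:R * wgt k <= k.+1%:R * wgt k.+1.
Proof.
rewrite wgtS; have -> : k%:R * wgt k = k%:R ^+ k.+1 * (expR (- k%:R) / k`!%:R).
  by rewrite exprS /wgt !mulrA.
rewrite !mulrA -[leRHS]mulrA -[leLHS]mulrA ler_wpM2r ?divr_ge0 ?expR_ge0 ?ler0n //.
have k0 : 0 < k.+1%:R :> R by rewrite ltr0n.
have -> : expR (-1) = expR (- (k.+1%:R^-1)) ^+ k.+1 :> R.
  by rewrite -expRM_natl mulrN divff ?gt_eqF.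
rewrite -exprS -exprMn; apply: lerXn2r; rewrite ?nnegrE ?mulr_ge0 ?expR_ge0 ?ler0n //.
apply: le_trans (ler_wpM2l (ltW k0) (expR_ge1Dx _)).
by rewrite mulrDr mulr1 mulrN divff ?gt_eqF // -natr1 addrK.
Qed.

Lemma mul_wgt_incr : {homo (fun k => k%:R * wgt k) : m n / (m <= n)%N >-> m <= n}.
Proof.
apply: homo_leq => [y|y z t|n]; [exact: lexx|exact: le_trans|exact: mul_wgt_incrS].
Qed.

Lemma wgt_diff k : wgt k - wgt k.+1 <= wgt k / k.+1%:R.
Proof.
have k0 : 0 < k.+1%:R :> R by rewrite ltr0n.
rewrite ler_pdivlMr // mulrBl; have := mul_wgt_incrS k; rewrite -!natr1; lra.
Qed.

(** For [j < n], use [(n-j) w_(n-j) <= n w_n] and [n <= (j+1)(n-j)]. The factor [e] comes from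
    [j = n], where [w_0 = e w_1]. *)
Lemma wgt_sub n j : (j <= n)%N -> wgt (n - j) <= expR 1 * j.+1%:R * wgt n.
Proof.
move=> jn; have e1 : 1 <= expR 1 :> R by rewrite -[leLHS]expR0 ler_expR.
have [nj|nj] := eqVneq j n.
  rewrite nj subnn wgt0; case: n {jn nj} => [|n]; first by rewrite wgt0 !mulr1.
  have := @mul_wgt_incr 1 n.+1 isT; rewrite mul1r wgt1 => h.
  have := ler_wpM2l (expR_ge0 1) h; rewrite divff ?gt_eqF ?expR_gt0 // => h2.
  apply: le_trans h2 _; rewrite mulrA ler_wpM2r ?wgt_ge0 // ler_wpM2l ?expR_ge0 //.
  by rewrite ler_nat.
have nj0 : (0 < n - j)%N by rewrite subn_gt0 ltn_neqAle nj.
have r0 : 0 < (n - j)%:R :> R by rewrite ltr0n.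
have h1 : (n - j)%:R * wgt (n - j) <= n%:R * wgt n by apply: mul_wgt_incr; exact: leq_subr.
have h2 : n%:R <= j.+1%:R * (n - j)%:R :> R by rewrite -natrM ler_nat leq_mul_sub // -subn_gt0.
have h3 : wgt (n - j) <= j.+1%:R * wgt n.
  rewrite -(ler_pM2l r0); apply: le_trans h1 _.
  have -> : (n - j)%:R * (j.+1%:R * wgt n) = j.+1%:R * (n - j)%:R * wgt n by ring.
  by rewrite ler_wpM2r ?wgt_ge0.
apply: le_trans h3 _; rewrite -mulrA ler_peMl // mulr_ge0 ?ler0n ?wgt_ge0 //.
Qed.

End StirlingWeights.

(** * Renewal sequences and their weighted analogues *)

Section Renewal.
Variable R : realType.
Implicit Types (f a : fps R).

Lemma psum1E f n : psum f 1 n = \sum_(i < n) f i.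
Proof. by apply: eq_bigr => i _; rewrite expr1n mulr1. Qed.

(** Each application of the Euler operator costs some radius: from [x] to the midpoint [y], then
    from [y] to 1. *)
Lemma second_moment a (x K : R) : nneg a -> 1 < x -> (forall n, psum a x n <= K) ->
  exists M, forall n, \sum_(i < n) a i * i.+1%:R ^+ 2 <= M.
Proof.
move=> a0 x1 aK; pose y := (1 + x) / 2.
have [y1 yx] : 1 < y /\ y < x by rewrite /y; split; lra.
have y0 : 0 <= y by lra.
have ta0 : nneg (fps_theta a) by move=> n; rewrite /fps_theta mulrn_wge0.
have h1 := psum_theta_le a0 y0 yx aK.
have h2 := psum_theta_le ta0 ler01 y1 h1.
have h3 n : psum (fps_theta a) 1 n <= y * K / (x - y).
  by apply: le_trans (h1 n); apply: le_psum => //; exact: ltW.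
have h4 n : psum a 1 n <= K by apply: le_trans (aK n); apply: le_psum => //; exact: ltW.
exists (1 * (y * K / (x - y)) / (y - 1) + 2 * (y * K / (x - y)) + K) => n.
apply: le_trans (lerD (lerD (h2 n) (ler_wpM2l _ (h3 n))) (h4 n)); last by [].
rewrite !psum1E mulr_sumr -!big_split; apply: ler_sum => i _ /=.
have tE (h : fps R) : fps_theta h i = h i * i%:R by rewrite /fps_theta mulr_natr.
rewrite !tE -natr1.
have -> // : a i * i%:R * i%:R + 2 * (a i * i%:R) + a i = a i * (i%:R + 1) ^+ 2 by ring.
Qed.

Lemma sum_geom_bound (x : R) n : 0 <= x -> x < 1 -> \sum_(i < n) x ^+ i <= 1 / (1 - x).
Proof.
move=> x0 x1; have x10 : 0 < 1 - x by rewrite subr_gt0.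
suff h : (\sum_(i < n) x ^+ i) * (1 - x) = 1 - x ^+ n.
  by rewrite ler_pdivlMr // h gerBl exprn_ge0.
elim: n => [|n IHn]; first by rewrite big_ord0 mul0r expr0 subrr.
by rewrite big_ord_recr /= mulrDl IHn exprS; ring.
Qed.

Variables (f : fps R) (nu x0 K0 : R).
Hypotheses (f_ge0 : nneg f) (f0 : f 0%N = 0) (f_le1 : forall n, psum f 1 n <= 1).
Hypothesis f_sum : forall eps, 0 < eps -> exists n, 1 - eps < psum f 1 n.
Hypotheses (f_mean : forall n, \sum_(i < n) f i * i.-1%:R <= nu) (nu_lt1 : nu < 1).
Hypotheses (x0_gt1 : 1 < x0) (f_x0 : forall n, psum f x0 n <= K0).

(** [q] is the tail series [(1 - f)/(1 - z)] and [u] the renewal series [1/(1 - f)]. The series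
    [eta] bounds [beta - b], by [w_k - w_(k+1) <= w_k/(k+1)]. *)
Let ones : fps R := fun=> 1.
Let q : fps R := ones * (1 - f).
Let u : fps R := fps_comp (fun=> 1) f.
Let b : fps R := fps_comp (@wgt R) f.
Let beta : fps R := fps_comp (fun k => wgt R k.+1) f.
Let eta : fps R := fps_comp (fun k => wgt R k / k.+1%:R) f.
Let gamma : fps R := f * eta.

Lemma ones_shift : (1 - fps_shift R) * ones = 1.
Proof.
rewrite mulrBl mul1r fps_shiftM; apply/funext => -[|n]; rewrite fpsBE fps1E /=.
  by rewrite subr0.
by rewrite subrr.
Qed.

Lemma tailE n : q n = 1 - psum f 1 n.+1.
Proof.
rewrite psum1E /q fpsME; under eq_bigr => i _ do rewrite mul1r.
rewrite -(big_mkord xpredT (fun i => (1 - f) (n - i)%N)) big_nat_rev /= add0n.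
under eq_big_nat => i /andP[_ ilt] do rewrite subSS subKn //.
rewrite big_mkord big_ord_recl fpsBE fps1E f0 subr0 big_ord_recl f0 add0r -sumrN.
by congr (_ + _); apply: eq_bigr => i _; rewrite fpsBE fps1E sub0r.
Qed.

Lemma tail_ge0 n : 0 <= q n. Proof. by rewrite tailE subr_ge0. Qed.

Lemma tail0 : q 0%N = 1. Proof. by rewrite tailE /psum big_ord1 f0 mul0r subr0. Qed.

Lemma f_sum_large eps M : 0 < eps -> exists2 n, (M <= n)%N & 1 - eps < psum f 1 n.
Proof.
move=> /f_sum[n hn]; exists (M + n)%N; first exact: leq_addr.
by apply: lt_le_trans hn _; apply: psum_homo => //; exact: leq_addl.
Qed.

(** Markov's inequality for the exponential moment at [x0], with the total mass 1 approached by a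
    finite partial sum. *)
Lemma tail_decay n : q n * x0 ^+ n <= K0.
Proof.
have x00 : 0 <= x0 by apply: ltW; apply: lt_trans x0_gt1.
have xn0 : 0 < x0 ^+ n by rewrite exprn_gt0 // (lt_trans _ x0_gt1).
rewrite -ler_pdivlMr //; apply/ler_addgt0Pr => eps eps0.
have [N nN hN] := f_sum_large n.+1 eps0.
suff h : psum f 1 N - psum f 1 n.+1 <= K0 / x0 ^+ n by rewrite tailE; lra.
rewrite ler_pdivlMr //; apply: le_trans (f_x0 N).
move: nN => /subnK <-; elim: (N - n.+1)%N => [|j IHj].
  by rewrite add0n subrr mul0r psum_ge0.
rewrite addSn !(psumS _ _ (j + n.+1)) expr1n mulr1.
rewrite addrAC mulrDl lerD // ler_wpM2l // ler_weXn2l ?(ltW x0_gt1) //.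
by rewrite addnS leqW // leq_addl.
Qed.

Lemma sum_tail_le n : \sum_(j < n) q j.+1 <= nu.
Proof.
(* Abel summation. The boundary term [n q_n] is then charged to the indices beyond [n], where
   [i - 1 >= n]. *)
have sumE : \sum_(j < n) q j.+1 = n%:R * q n + \sum_(i < n.+1) f i * i.-1%:R.
  elim: n => [|n IHn]; first by rewrite big_ord0 big_ord1 f0 !mul0r addr0.
  rewrite big_ord_recr /= IHn [in RHS]big_ord_recr /= !tailE !psumS !expr1n !mulr1.
  by rewrite -natr1; ring.
rewrite sumE; apply/ler_addgt0Pr => eps eps0.
have n0 : 0 < n.+1%:R :> R by rewrite ltr0n.
have e0 : 0 < eps / n.+1%:R by rewrite divr_gt0.
have [N nN hN] := f_sum_large n.+1 e0.
have h : n%:R * (psum f 1 N - psum f 1 n.+1) + \sum_(i < n.+1) f i * i.-1%:R <=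
         \sum_(i < N) f i * i.-1%:R.
  move: {hN} nN => /subnK <-; elim: (N - n.+1)%N => [|j IHj].
    by rewrite add0n subrr mulr0 add0r.
  rewrite addSn (psumS _ _ (j + n.+1)) expr1n mulr1 [leRHS]big_ord_recr /=.
  have : f (j + n.+1)%N * n%:R <= f (j + n.+1)%N * (j + n.+1).-1%:R.
    by rewrite ler_wpM2l // ler_nat; lia.
  by move: IHj; lra.
have := f_mean N; rewrite tailE.
have h2 : n%:R * (1 - psum f 1 N) <= eps.
  apply: (@le_trans _ _ (n%:R * (eps / n.+1%:R))); first by rewrite ler_wpM2l ?ler0n // lerBlDr -lerBlDl ltW.
  rewrite mulrA ler_pdivrMr // mulrC ler_wpM2l ?(ltW eps0) // ler_nat; lia.
lra.
Qed.

Lemma renewalE : (1 - f) * u = 1.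
Proof.
rewrite mulrBl mul1r {1}/u fps_comp_recl // addrK.
by apply/funext => n; rewrite fps1E; case: eqP.
Qed.

Lemma renewal_ge0 : nneg u. Proof. by apply: nneg_comp => // n. Qed.

(** Decomposition by the age [j] of the last renewal: [q u = 1/(1 - z)]. *)
Lemma sum_tail_renewal n : \sum_(j < n.+1) q j * u (n - j)%N = 1.
Proof. by have : (q * u) n = 1 by rewrite /q -mulrA renewalE mulr1. Qed.

Lemma renewal_le1 n : u n <= 1.
Proof.
rewrite -(sum_tail_renewal n) big_ord_recl tail0 mul1r subn0 lerDl sumr_ge0 // => i _.
by rewrite mulr_ge0 ?tail_ge0 // renewal_ge0.
Qed.

Lemma renewal_lower n : 1 - nu <= u n.
Proof.
have := sum_tail_renewal n; rewrite big_ord_recl tail0 mul1r subn0 => h.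
have : \sum_(i < n) q (lift ord0 i) * u (n - lift ord0 i)%N <= nu; last lra.
apply: le_trans (sum_tail_le n); apply: ler_sum => i _; rewrite lift0.
by rewrite ler_piMr ?tail_ge0 ?renewal_le1.
Qed.

(** The increments of [u], and also the inverse of [q]. *)
Let g : fps R := (1 - fps_shift R) * u.
Let absg : fps R := fun n => `|g n|.

Lemma tail_inverse : q * g = 1.
Proof.
rewrite /q /g.
have -> : ones * (1 - f) * ((1 - fps_shift R) * u) = ((1 - fps_shift R) * ones) * ((1 - f) * u) by ring.
by rewrite ones_shift renewalE mulr1.
Qed.

Lemma absg_moment : exists M, forall n, \sum_(i < n) absg i * i.+1%:R ^+ 2 <= M.
Proof.
pose Q : fps R := q - 1.
have Q_S j : Q j.+1 = q j.+1 by rewrite /Q fpsBE fps1E subr0.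
have Q_0 : Q 0%N = 0 by rewrite /Q fpsBE fps1E tail0 subrr.
have Q_ge0 : nneg Q by case=> [|j]; rewrite ?Q_0 ?Q_S ?tail_ge0.
have absg_ge0 : nneg absg by move=> n; exact: normr_ge0.
have psumQ_1 n : psum Q 1 n <= nu.
  case: n => [|n]; first by rewrite /psum big_ord0; apply: le_trans (sum_tail_le 0); rewrite big_ord0.
  rewrite psum1E big_ord_recl Q_0 add0r; apply: le_trans (sum_tail_le n).
  by apply: ler_sum => i _; rewrite lift0 Q_S.
have x00 : 0 < x0 by apply: lt_trans x0_gt1.
pose y := (1 + x0) / 2.
have [y1 yx] : 1 < y /\ y < x0 by have := x0_gt1; rewrite /y => h; split; lra.
have y0 : 0 <= y by lra.
have yx1 : y / x0 < 1 by rewrite ltr_pdivrMr // mul1r.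
have yx0 : 0 <= y / x0 by rewrite divr_ge0 // ltW.
have K00 : 0 <= K0 by apply: le_trans (f_x0 0%N); rewrite /psum big_ord0.
have psumQ_y n : psum Q y n <= K0 * (1 / (1 - y / x0)).
  apply: le_trans (ler_wpM2l K00 (sum_geom_bound n yx0 yx1)).
  rewrite mulr_sumr; apply: ler_sum => i _.
  have -> : K0 * (y / x0) ^+ i = K0 * y ^+ i / x0 ^+ i by rewrite expr_div_n mulrA.
  rewrite ler_pdivlMr ?exprn_gt0 //.
  rewrite mulrAC ler_wpM2r ?exprn_ge0 //; apply: le_trans (tail_decay i).
  by rewrite ler_wpM2r ?exprn_ge0 ?(ltW x00) // /Q fpsBE fps1E gerBl ler0n.
have nu0 : 0 <= nu by apply: le_trans (psumQ_1 0%N); rewrite /psum big_ord0.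
have nu2 : nu < (1 + nu) / 2 by have := nu_lt1; lra.
(* [Q] has mass at most [nu < 1] at 1, so it stays below [(1 + nu)/2 < 1] slightly beyond 1. *)
have [x [x1 _ Qx]] := psum_right_continuous Q_ge0 ler01 y1 psumQ_y psumQ_1 nu2.
have x_ge0 : 0 <= x by lra.
have absg_le n : absg n <= (1 + Q * absg) n.
  have gE : g = 1 - Q * g by rewrite -tail_inverse /Q; ring.
  rewrite /absg {1}gE -/absg.
  rewrite fpsBE fpsDE; apply: le_trans (ler_normB _ _) _; apply: lerD.
    by rewrite fps1E; case: eqP; rewrite ?normr1 ?normr0.
  rewrite fpsME; apply: le_trans (ler_norm_sum _ _ _) _.
  by apply: ler_sum => i _; rewrite normrM (ger0_norm (Q_ge0 _)).
apply: (@second_moment absg x (1 / (1 - (1 + nu) / 2))) => // n.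
rewrite ler_pdivlMr; last by have := nu_lt1; lra.
(* The same finite partial sum of [absg] stands on both sides, so the inequality can be solved for
   it: this is the Neumann series bound. *)
have : psum absg x n <= 1 + psum Q x n * psum absg x n.
  apply: le_trans (_ : psum (1 + Q * absg) x n <= _).
    by apply: ler_sum => i _; rewrite ler_wpM2r ?exprn_ge0.
  have -> : psum (1 + Q * absg) x n = psum 1 x n + psum (Q * absg) x n.
    by rewrite -big_split; apply: eq_bigr => i _; rewrite fpsDE mulrDl.
  apply: lerD; last exact: psumM_le.
  case: n => [|n]; first by rewrite /psum big_ord0.
  rewrite /psum big_ord_recl mulr1 big1 ?addr0 // => i _.
  by rewrite fps1E mul0r.
have := Qx n; have : 0 <= psum absg x n by exact: psum_ge0.
nra.
Qed.

Lemma boltzmannE n : b n = \sum_(k < n.+1) wgt R k * (f ^+ k) n.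
Proof. by rewrite /b fps_compE. Qed.

Lemma fX_ge0 k n : 0 <= (f ^+ k) n. Proof. exact: nnegX. Qed.

Lemma boltzmann_lower n : (1 - nu) * wgt R n <= b n.
Proof.
rewrite mulrC; apply: le_trans (ler_wpM2l (wgt_ge0 R n) (renewal_lower n)) _.
rewrite boltzmannE /u fps_compE mulr_sumr; apply: ler_sum => k _.
by rewrite mul1r ler_wpM2r ?fX_ge0 ?wgt_decr // -ltnS.
Qed.

(** Decreasing weights give only the lower bound. Multiplying by [n] replaces [w_(k+1)] by
    [(k+1) w_(k+1)], which increases and is at most [n w_n]; what remains is the mean of [f], at
    most [1 + nu]. *)
Lemma boltzmann_upper n : b n <= (1 + nu) * wgt R n.
Proof.
have nu0 : 0 <= nu by apply: le_trans (f_mean 0%N); rewrite big_ord0.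
have b00 : b 0%N = 1 by rewrite boltzmannE big_ord1 wgt0 mul1r expr0.
case: n => [|n]; first by rewrite b00 wgt0 mulr1 lerDl.
have n0 : 0 < n.+1%:R :> R by rewrite ltr0n.
rewrite -(ler_pM2r n0).
have -> : b n.+1 * n.+1%:R = fps_theta b n.+1 by rewrite /fps_theta mulr_natr.
rewrite /b fps_theta_comp // fpsME.
have h (i : 'I_n.+2) : fps_theta f i * fps_comp (fun k => wgt R k.+1 *+ k.+1) f (n.+1 - i)
   <= (f i * i%:R) * (n.+1%:R * wgt R n.+1).
  (* The vanishing term [i = 0] is set apart because [k.+1 <= n.+1] holds only for [i >= 1]. *)
  case: (posnP i) => [->|i0]; first by rewrite /fps_theta mulr0n !mulr0 !mul0r.
  rewrite /fps_theta -[f i *+ i]mulr_natr ler_wpM2l ?mulr_ge0 ?ler0n //.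
  apply: le_trans (_ : _ <= n.+1%:R * wgt R n.+1 * u (n.+1 - i)%N) _; last first.
    by rewrite ler_piMr ?renewal_le1 // mulr_ge0 ?ler0n ?wgt_ge0.
  rewrite fps_compE /u fps_compE mulr_sumr; apply: ler_sum => k _.
  rewrite mul1r ler_wpM2r ?fX_ge0 // -[_ *+ k.+1]mulr_natl mul_wgt_incr //.
  by have := ltn_ord k; lia.
apply: le_trans (ler_sum _ (fun i _ => h i)) _.
have -> : (1 + nu) * wgt R n.+1 * n.+1%:R = (1 + nu) * (n.+1%:R * wgt R n.+1) by ring.
rewrite -mulr_suml ler_wpM2r ?mulr_ge0 ?ler0n ?wgt_ge0 //.
have -> : 1 + nu = nu + 1 by rewrite addrC.
apply: le_trans (lerD (f_mean n.+2) (f_le1 n.+2)); rewrite psum1E -big_split /=.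
apply: ler_sum => -[[|i] lti] _ /=; first by rewrite f0 !mul0r addr0.
by rewrite -natr1 mulrDr mulr1.
Qed.

Lemma eta_ge0 : nneg eta.
Proof. by apply: nneg_comp => // k; rewrite divr_ge0 ?wgt_ge0 ?ler0n. Qed.

Lemma gamma_ge0 : nneg gamma. Proof. by apply: nnegM => //; exact: eta_ge0. Qed.

Lemma eta_le_gamma n : (0 < n)%N -> eta n <= gamma n.
Proof.
move=> n0; rewrite {1}/eta fps_comp_recl // fpsDE gtn_eqF // add0r !fpsME.
apply: ler_sum => i _; rewrite ler_wpM2l // /eta !fps_compE.
apply: ler_sum => k _; rewrite ler_wpM2r ?fX_ge0 //.
apply: ler_pM; rewrite ?wgt_ge0 ?invr_ge0 ?ler0n ?wgt_decrS //.
by rewrite lef_pV2 ?posrE ?ltr0n // ler_nat.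
Qed.

(* Each of the [k] factors of [f ^+ k] carries in the mean a share [1/k] of the
   exponent, whence [n gamma_n = sum_j j f_j b_(n-j)]. *)
Lemma theta_gamma : fps_theta gamma = fps_theta f * b.
Proof.
pose a : fps R := fun k => if k is j.+1 then wgt R j / j.+1%:R else 0.
have -> : gamma = fps_comp a f.
  rewrite [RHS]fps_comp_recl // /gamma /eta.
  rewrite (_ : (fun n : nat => if n == 0%N then a 0%N else 0) = 0) ?add0r //.
  by apply/funext => n; case: ifP.
rewrite fps_theta_comp //; congr (_ * _); congr (fps_comp _ f).
by apply/funext => k; rewrite /a -[_ *+ k.+1]mulr_natr divfK // pnatr_eq0.
Qed.

(** In [n gamma_n = sum_i i f_i b_(n-i)], replacing [w_(n-i)] by [w_n] costs [i+1], so a second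
    moment of [f] suffices. *)
Lemma gamma_bound : exists2 K, 0 <= K & forall n, n%:R * gamma n <= K * wgt R n.
Proof.
have [M fM] := second_moment f_ge0 x0_gt1 f_x0.
have M0 : 0 <= M by apply: le_trans (fM 0%N); rewrite big_ord0.
have nu0 : 0 <= nu by apply: le_trans (f_mean 0%N); rewrite big_ord0.
have c0 : 0 <= (1 + nu) * expR 1 by rewrite mulr_ge0 ?expR_ge0 // addr_ge0.
exists ((1 + nu) * expR 1 * M) => [|n]; first by rewrite mulr_ge0.
have -> : n%:R * gamma n = fps_theta gamma n by rewrite /fps_theta mulr_natl.
rewrite theta_gamma fpsME mulrAC; apply: le_trans (ler_wpM2l _ (fM n.+1)); last first.
  by rewrite mulr_ge0 ?wgt_ge0.
rewrite mulr_sumr; apply: ler_sum => i _.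
have h : b (n - i)%N <= (1 + nu) * (expR 1 * i.+1%:R * wgt R n).
  apply: le_trans (boltzmann_upper _) _; rewrite ler_wpM2l ?addr_ge0 //.
  by apply: wgt_sub; rewrite -ltnS.
rewrite /fps_theta -[f i *+ i]mulr_natr.
apply: le_trans (ler_wpM2l _ h) _; first by rewrite mulr_ge0 ?ler0n.
have -> : (1 + nu) * expR 1 * wgt R n * (f i * i.+1%:R ^+ 2) =
   f i * i.+1%:R * ((1 + nu) * (expR 1 * i.+1%:R * wgt R n)) by ring.
rewrite ler_wpM2r //; last by rewrite ler_wpM2l // ler_nat.
by rewrite !mulr_ge0 ?wgt_ge0 ?expR_ge0 ?addr_ge0.
Qed.

Lemma beta_boltzmann n : `|beta n - b n| <= eta n.
Proof.
rewrite /beta boltzmannE fps_compE -sumrB /eta fps_compE; apply: le_trans (ler_norm_sum _ _ _) _.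
apply: ler_sum => k _; rewrite -mulrBl normrM (ger0_norm (fX_ge0 _ _)) ler_wpM2r ?fX_ge0 //.
by rewrite distrC ger0_norm ?wgt_diff // subr_ge0 wgt_decrS.
Qed.

Let c : fps R := (1 - f) * b.

Lemma numer0 : c 0%N = 1.
Proof. by rewrite /c fpsM0 fpsBE fps1E f0 subr0 mul1r boltzmannE big_ord1 wgt0 mul1r expr0. Qed.

Lemma numer_gamma n : (0 < n)%N -> `|c n| <= gamma n.
Proof.
(* From [b = 1 + f beta]: away from index 0 the product [(1 - f) b] sees only the small difference
   [beta - b]. *)
move=> n0; have -> : c = (fun n => if n == 0%N then 1 else 0) + f * (beta - b).
  rewrite /c mulrBl mul1r {1}/b fps_comp_recl // wgt0 -/beta mulrBr.
  by rewrite addrA.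
rewrite fpsDE gtn_eqF // add0r !fpsME; apply: le_trans (ler_norm_sum _ _ _) _.
apply: ler_sum => i _; rewrite normrM (ger0_norm (f_ge0 _)) ler_wpM2l //.
exact: beta_boltzmann.
Qed.

Lemma boltzmann_diff n : b n.+1 - b n = (c * g) n.+1.
Proof.
have -> : c * g = b - fps_shift R * b.
  rewrite /c /g.
  have -> : (1 - f) * b * ((1 - fps_shift R) * u) = ((1 - f) * u) * (b - fps_shift R * b) by ring.
  by rewrite renewalE mul1r.
by rewrite fps_shiftM fpsBE.
Qed.

(** Convolution of [c_j = O(w_j / (j+1))] with [g]: moving both [w_j] and [1/(j+1)] to the full
    index costs [(i+1)^2], the moment provided by [absg_moment]. *)
Lemma boltzmann_diff_bound : exists2 K, 0 <= K &
  forall n, `|b n.+1 - b n| <= K * wgt R n.+1 / n.+2%:R.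
Proof.
have [K1 K10 gK] := gamma_bound.
have [M gM] := absg_moment.
have M0 : 0 <= M by apply: le_trans (gM 0%N); rewrite big_ord0.
(* The 1 covers [c_0 = 1], and the 2 comes from [i + 1 <= 2 i] for [i >= 1]. *)
pose K2 := 2 * K1 + 1; have K20 : 0 <= K2 by rewrite /K2; lra.
have cK i : `|c i| <= K2 * wgt R i / i.+1%:R.
  case: i => [|i]; first by rewrite numer0 normr1 wgt0 mulr1 divr1 /K2; lra.
  have i0 : 0 < i.+1%:R :> R by rewrite ltr0n.
  have i2 : 0 < i.+2%:R :> R by rewrite ltr0n.
  rewrite ler_pdivlMr //; apply: le_trans (ler_wpM2r (ltW i2) (numer_gamma (ltn0Sn i))) _.
  have h := gK i.+1; have w0 := wgt_ge0 R i.+1; have g0 := gamma_ge0 i.+1.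
  have h2 : gamma i.+1 * i.+2%:R <= gamma i.+1 * (2 * i.+1%:R).
    by rewrite ler_wpM2l // -natrM ler_nat mul2n -addnn addnS ltnS leq_addr.
  by rewrite /K2; lra.
exists (K2 * expR 1 * M) => [|n]; first by rewrite !mulr_ge0 ?expR_ge0.
have n0 : 0 < n.+2%:R :> R by rewrite ltr0n.
rewrite boltzmann_diff mulrC fpsME; apply: le_trans (ler_norm_sum _ _ _) _.
have -> : K2 * expR 1 * M * wgt R n.+1 / n.+2%:R = (K2 * expR 1 * wgt R n.+1 / n.+2%:R) * M by ring.
apply: le_trans (ler_wpM2l _ (gM n.+2)); last first.
  by rewrite divr_ge0 ?ler0n // !mulr_ge0 ?expR_ge0 ?wgt_ge0.
rewrite mulr_sumr; apply: ler_sum => i _; rewrite normrM -/(absg i).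
have i0 : 0 <= absg i by exact: normr_ge0.
have h1 := cK (n.+1 - i)%N; set j := (n.+1 - i)%N in h1 *.
have j0 : 0 < j.+1%:R :> R by rewrite ltr0n.
have iN : (i <= n.+1)%N by rewrite -ltnS.
have h2 : wgt R j <= expR 1 * i.+1%:R * wgt R n.+1 by exact: wgt_sub.
have h3 : j.+1%:R^-1 <= i.+1%:R / n.+2%:R :> R.
  rewrite ler_pdivlMr // mulrC ler_pdivrMr // -natrM ler_nat /j.
  exact: leq_mul_subS.
have h4 : `|c j| <= K2 * (expR 1 * i.+1%:R * wgt R n.+1) * (i.+1%:R / n.+2%:R).
  apply: le_trans h1 _; apply: ler_pM; rewrite ?invr_ge0 ?ler0n ?mulr_ge0 ?wgt_ge0 //.
  by rewrite ler_wpM2l.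
apply: le_trans (ler_wpM2l i0 h4) _.
by rewrite le_eqVlt; apply/orP; left; apply/eqP; ring.
Qed.

Lemma renewal_ratio j : exists2 K, 0 <= K & forall n, (j < n)%N ->
  0 < b n /\ `|beta (n - j)%N - b n| <= K * b n / n%:R.
Proof.
have [K1 K10 gK] := gamma_bound.
have [K3 K30 dK] := boltzmann_diff_bound.
have nu1 : 0 < 1 - nu by rewrite subr_gt0.
(* [K1] bounds [beta - b] at [n - j] and [j K3] the [j] steps from there to [n]; the other factors
   move [w] and [1/(n-j)] to the index [n]. *)
pose K4 := (K1 + j%:R * K3) * (expR 1 * j.+1%:R) * j.+1%:R.
have K40 : 0 <= K4 by rewrite !mulr_ge0 ?expR_ge0 ?ler0n // addr_ge0 // mulr_ge0 ?ler0n.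
exists (K4 / (1 - nu)) => [|n jn]; first by rewrite divr_ge0 // ltW.
have wn0 : 0 < wgt R n.
  by rewrite divr_gt0 ?fact_gt0R // mulr_gt0 ?expR_gt0 // exprn_gt0 // ltr0n; case: (n) jn.
have bn := boltzmann_lower n.
have bn0 : 0 < b n by apply: lt_le_trans bn; rewrite mulr_gt0.
split=> //; set N := (n - j)%N.
have N0 : (0 < N)%N by rewrite subn_gt0.
have NR0 : 0 < N%:R :> R by rewrite ltr0n.
have nR0 : 0 < n%:R :> R by rewrite ltr0n; case: (n) jn.
have h1 : `|beta N - b N| <= K1 * wgt R N / N%:R.
  apply: le_trans (beta_boltzmann N) _; apply: le_trans (eta_le_gamma N0) _.
  by rewrite ler_pdivlMr // mulrC gK.
have h2 i : `|b (N + i)%N - b N| <= i%:R * (K3 * wgt R N / N%:R).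
  elim: i => [|i IHi]; first by rewrite addn0 subrr normr0 mul0r.
  rewrite addnS -natr1 mulrDl mul1r.
  have -> : b (N + i).+1 - b N = (b (N + i)%N - b N) + (b (N + i).+1 - b (N + i)%N) by ring.
  apply: le_trans (ler_normD _ _) _; apply: lerD => //; apply: le_trans (dK _) _.
  apply: ler_pM; rewrite ?invr_ge0 ?ler0n ?mulr_ge0 ?wgt_ge0 //.
    by rewrite ler_wpM2l // wgt_decr // leqW // leq_addr.
  by rewrite lef_pV2 ?posrE ?ltr0n // ler_nat (leq_trans (leq_addr i N)) // leqW.
have Nj : (N + j)%N = n by rewrite subnK // ltnW.
have h3 : `|beta N - b n| <= (K1 + j%:R * K3) * (wgt R N * N%:R^-1).
  have -> : beta N - b n = (beta N - b N) - (b n - b N) by ring.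
  apply: le_trans (ler_normB _ _) _; have := h2 j; rewrite Nj; move: h1.
  by rewrite -!mulrA; lra.
have h4 : wgt R N <= expR 1 * j.+1%:R * wgt R n by apply: wgt_sub; exact: ltnW.
have h5 : N%:R^-1 <= j.+1%:R / n%:R :> R.
  rewrite ler_pdivlMr // mulrC ler_pdivrMr // -natrM ler_nat.
  exact: leq_mul_sub.
have h6 : wgt R N * N%:R^-1 <= expR 1 * j.+1%:R * wgt R n * (j.+1%:R / n%:R).
  by apply: ler_pM; rewrite ?invr_ge0 ?ler0n ?wgt_ge0.
apply: le_trans h3 _; apply: le_trans (ler_wpM2l _ h6) _.
  by rewrite addr_ge0 // mulr_ge0 ?ler0n.
have -> : (K1 + j%:R * K3) * (expR 1 * j.+1%:R * wgt R n * (j.+1%:R / n%:R)) = (K4 / n%:R) * wgt R n.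
  by rewrite /K4; ring.
have -> : K4 / (1 - nu) * b n / n%:R = (K4 / n%:R) * (b n / (1 - nu)) by ring.
by rewrite ler_wpM2l ?divr_ge0 ?ler0n // ler_pdivlMr // mulrC.
Qed.

End Renewal.

(** * Sizes of the attached forests *)

Section ForestSizes.
Variable R : realType.

Local Notation e := (expR 1 : R).
Local Notation r := (rho R).
Local Notation zD := (fps_shift R * D_fps R).

(* The law of [1 + |F(v)|] in the critical Boltzmann model, since
   [r D(r) = 1/e]. *)
Definition node_law : fps R := fun n => e * (r ^+ n * zD n).

Let r_gt0 : 0 < r. Proof. by have := rho_ge_quarter R; lra. Qed.
Let e_gt0 : 0 < e. Proof. exact: expR_gt0. Qed.
Let r_lt1 : r < 1. Proof. by have := rho_lt_half R; lra. Qed.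

Lemma node_lawX k n : (node_law ^+ k) n = e ^+ k * (r ^+ n * (zD ^+ k) n).
Proof.
elim: k n => [|k IHk] n.
  rewrite !expr0 mul1r fps1E; case: eqVneq => [->|_]; first by rewrite mul1r.
  by rewrite mulr0.
rewrite !exprS !fpsME !mulr_sumr; apply: eq_bigr => i _; rewrite IHk /node_law.
have -> : r ^+ n = r ^+ i * r ^+ (n - i) by rewrite -exprD subnKC // -ltnS.
by ring.
Qed.

Lemma node_law_ge0 : nneg node_law.
Proof.
move=> n; apply: mulr_ge0; first exact: ltW.
apply: mulr_ge0; first by rewrite exprn_ge0 // ltW.
by apply: nnegM; [move=> k; rewrite ler0n | exact: nneg_D].
Qed.

Lemma node_law0 : node_law 0%N = 0.
Proof. by rewrite /node_law fps_shiftM !mulr0. Qed.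

Lemma node_lawS n : node_law n.+1 = e * r * (D_fps R n * r ^+ n).
Proof. by rewrite /node_law fps_shiftM /= exprS; ring. Qed.

Lemma psum_node_law n : psum node_law 1 n.+1 = e * r * psum (D_fps R) r n.
Proof.
rewrite psum1E big_ord_recl node_law0 add0r mulr_sumr.
by apply: eq_bigr => i _; rewrite lift0 node_lawS.
Qed.

Lemma psum_node_law_le1 n : psum node_law 1 n <= 1.
Proof.
case: n => [|n]; first by rewrite /psum big_ord0 ler01.
by rewrite psum_node_law; have := psumD_rho R n; lra.
Qed.

Lemma psum_node_law_sup eps : 0 < eps -> exists n, 1 - eps < psum node_law 1 n.
Proof.
move=> eps0; apply: contrapT => h.
have er0 : 0 < e * r by exact: mulr_gt0.
have : D_value r <= (1 - eps) / (e * r).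
  apply: limr_le; first exact: cvg_D.
  near=> n; rewrite -psum_pseries ler_pdivlMr // mulrC -psum_node_law leNgt.
  by apply/negP => hn; apply: h; exists n.+1.
rewrite ler_pdivlMr //; have := D_rho R; lra.
Unshelve. all: by end_near. Qed.

(** The mean forest size is [e r (theta D)(r)], and [theta D = theta(logD) D] splits it into a
    factor at most [r/(1 - r)] and the total mass. *)
Lemma node_law_mean n : \sum_(i < n) node_law i * i.-1%:R <= r / (1 - r).
Proof.
have c0 : 0 <= r / (1 - r) by rewrite divr_ge0 ?subr_ge0 // ltW.
have r0 := ltW r_gt0.
case: n => [|n]; first by rewrite big_ord0.
have -> : \sum_(i < n.+1) node_law i * i.-1%:R = e * r * psum (fps_theta (D_fps R)) r n.
  rewrite big_ord_recl node_law0 mul0r add0r mulr_sumr; apply: eq_bigr => i _.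
  by rewrite lift0 node_lawS /fps_theta -[_ *+ i]mulr_natr; ring.
have tl0 : nneg (fps_theta (logD_fps R)) by move=> k; rewrite /fps_theta mulrn_wge0 // nneg_logD.
have h1 : psum (fps_theta (D_fps R)) r n <= psum (fps_theta (logD_fps R)) r n * psum (D_fps R) r n.
  by rewrite theta_D; apply: psumM_le => //; exact: nneg_D.
have h2 := psum_theta_logD_le n r0 r_lt1 (psumT_rho R).
have D0' : 0 <= psum (D_fps R) r n by apply: psum_ge0 => //; exact: nneg_D.
have h3 := psumD_rho R n.
apply: (@le_trans _ _ (e * r * (r / (1 - r) * psum (D_fps R) r n))).
  apply: ler_wpM2l; first by rewrite mulr_ge0 // ltW.
  by apply: le_trans h1 _; exact: ler_wpM2r.
have -> : e * r * (r / (1 - r) * psum (D_fps R) r n) = r / (1 - r) * (r * psum (D_fps R) r n * e) by ring.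
exact: ler_piMr.
Qed.

Lemma node_law_mean_lt1 : r / (1 - r) < 1.
Proof.
by rewrite ltr_pdivrMr ?subr_gt0 // mul1r; have := rho_lt_half R; lra.
Qed.

Lemma node_law_radius n : psum node_law (Num.sqrt r / r) n <=
  e * (Num.sqrt r * expR (1 / (1 - Num.sqrt r))).
Proof.
have c0 : 0 <= e * (Num.sqrt r * expR (1 / (1 - Num.sqrt r))).
  by rewrite !mulr_ge0 ?sqrtr_ge0 ?expR_ge0.
case: n => [|n]; first by rewrite /psum big_ord0.
have -> : psum node_law (Num.sqrt r / r) n.+1 = e * psum zD (Num.sqrt r) n.+1.
  rewrite /psum mulr_sumr; apply: eq_bigr => i _; rewrite /node_law expr_div_n.
  by field; rewrite expf_neq0 // gt_eqF.
rewrite psum_shift; apply: ler_wpM2l; first exact: ltW.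
by apply: ler_wpM2l; [exact: sqrtr_ge0 | exact: psumD_sqrt_rho].
Qed.

(** At index 0 the two sides would differ, being 0 and [w_0 = 1]; hence the condition [0 < n] in
    [sum_dTm1_wgt], where the power 0 of [zD] does not contribute. *)
Lemma C_coef_wgt k : C_coef R k.+1 * k.+1%:R = wgt R k.+1 * e ^+ k.+1.
Proof.
rewrite /wgt -expRM_natr mul1r /C_coef natrX exprSr.
have h : expR (- k.+1%:R) * expR k.+1%:R = 1 :> R by rewrite -expRD addNr expR0.
move: (expR (- k.+1%:R)) (expR k.+1%:R) h => x y xy.
by rewrite -[LHS]mulr1 -xy; ring.
Qed.

Lemma dC_fpsE n : dC_fps R n = e / r ^+ n * fps_comp (fun k => wgt R k.+1) node_law n.
Proof.
rewrite /dC_fps !fps_compE mulr_sumr; apply: eq_bigr => k _.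
rewrite node_lawX C_coef_wgt exprS; field.
by rewrite expf_neq0 // gt_eqF.
Qed.

Lemma sum_dTm1_wgt n : (0 < n)%N -> \sum_(k \in [set: nat]) dTm1 R k n =
  fps_comp (wgt R) node_law n / r ^+ n.
Proof.
move=> n0; rewrite sum_dTm1_coef // !fps_compE mulr_suml.
have term k : C_coef R k * k%:R * (zD ^+ k) n =
    wgt R k * (e ^+ k * (r ^+ n * (zD ^+ k) n)) / r ^+ n.
  case: k => [|k]; last first.
    by rewrite C_coef_wgt; field; rewrite expf_neq0 // gt_eqF.
  by rewrite mulr0n mulr0 mul0r !expr0 fps1E gtn_eqF // !mulr0 mul0r.
by apply: eq_bigr => k _; rewrite node_lawX.
Qed.

Lemma prob_forestE m n : (m < n)%N ->
  0 < fps_comp (wgt R) node_law n ->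
  prob_forest R m n = D_coef R m * r ^+ m / D_value r *
   (fps_comp (fun k => wgt R k.+1) node_law (n - m.+1)%N / fps_comp (wgt R) node_law n).
Proof.
move=> mn b0; rewrite /prob_forest sum_dTm1_wgt; last by case: (n) mn.
rewrite dTm1_coef mn dC_fpsE.
set B := fps_comp _ _ n in b0 *; set beta := fps_comp _ _ _.
(* The criticality relation turns the factor [e r] left by the rescaling into [1/D(r)]. *)
have rD : D_value r = (e * r)^-1.
  have er0 : e * r != 0 by rewrite gt_eqF // mulr_gt0.
  by apply: (mulfI er0); rewrite mulfV //; have := D_rho R; lra.
have rn0 : r ^+ (n - m.+1) != 0 by rewrite expf_neq0 // gt_eqF.
have rm0 : r ^+ m != 0 by rewrite expf_neq0 // gt_eqF.
have -> : r ^+ n = r ^+ (n - m.+1) * (r ^+ m * r) by rewrite -exprSr -exprD subnK.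
rewrite rD invrK; field.
by rewrite (gt_eqF b0) (gt_eqF r_gt0) rm0 rn0.
Qed.

Lemma prob_forest_asymp m : exists eps : nat -> R,
  (eps : nat -> R^o) =O_\oo (fun n : nat => (n%:R : R)^-1 : R^o) /\
  \forall n \near \oo, prob_forest R m n =
    D_coef R m * r ^+ m / D_value r * (1 + eps n).
Proof.
have x0_gt1 : 1 < Num.sqrt r / r by rewrite ltr_pdivlMr // mul1r; exact: rho_lt_sqrt.
have [K K0 bK] := renewal_ratio node_law_ge0 node_law0 psum_node_law_le1
  psum_node_law_sup node_law_mean node_law_mean_lt1 x0_gt1 node_law_radius m.+1.
set b := fps_comp (wgt R) node_law in bK.
set beta := fps_comp (fun k => wgt R k.+1) node_law in bK.
exists (fun n => beta (n - m.+1)%N / b n - 1); split.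
  (* The constant must be positive, while [K] is only nonnegative. *)
  apply/eqO_exP; exists (K + 1); first by rewrite ltr_wpDl.
  near=> n; have mn : (m.+1 < n)%N by near: n; exact: nbhs_infty_gt.
  have [b0 h] := bK n mn.
  have n0 : 0 < n%:R :> R by rewrite ltr0n; case: (n) mn.
  have -> : beta (n - m.+1)%N / b n - 1 = (beta (n - m.+1)%N - b n) / b n.
    by field; rewrite gt_eqF.
  rewrite !normrM normfV (gtr0_norm b0) (ger0_norm (_ : 0 <= n%:R^-1)) ?invr_ge0 ?ler0n //.
  rewrite ler_pdivrMr //; apply: le_trans h _.
  have -> : K * b n / n%:R = K * (n%:R^-1 * b n) by ring.
  have -> : (K + 1) / n%:R * b n = (K + 1) * (n%:R^-1 * b n) by ring.
  by rewrite ler_wpM2r ?lerDl // mulr_ge0 ?invr_ge0 ?ler0n // ltW.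
near=> n; have mn : (m.+1 < n)%N by near: n; exact: nbhs_infty_gt.
have [b0 _] := bK n mn.
by rewrite prob_forestE // 1?ltnW // addrC subrK.
Unshelve. all: by end_near. Qed.

End ForestSizes.

Theorem theorem3 (R : realType) (m : nat) :
  [/\ Tm R m = fps_comp (fun k => (C_coef R k)%:P) (Tm_arg R m),
      forall n : nat, prob_forest R m n =
        (\sum_(s \in structures n) weight R s * (count_mem m s.2)%:R) /
        (\sum_(s \in structures n) weight R s * (nnodes s.1)%:R)
    & exists e : nat -> R,
        (e : nat -> R^o) =O_\oo (fun n : nat => (n%:R : R)^-1 : R^o) /\
        \forall n \near \oo, prob_forest R m n =
          D_coef R m * rho R ^+ m / D_value (rho R) * (1 + e n)].
Proof.
split; first exact: Tm_fps_comp.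
  by move=> n; rewrite /prob_forest dTm1E sum_dTm1_nnodes.
exact: prob_forest_asymp.
Qed.
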